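(* Let $0\le\beta\le5$ and let $M_t$, $t\in[0,T)$, be a family of smooth closed strictly convex surfaces in $\mathbb{R}^3$ flowing according to $\frac{d}{dt}X=-(|A|^2+\beta H^2)\nu$. Then $$\max_{M_t}\frac{(\lambda_1+\lambda_2)(\lambda_1-\lambda_2)^2}{2\lambda_1\lambda_2}$$ is non-increasing in time.
   Context: A closed surface is a compact connected embedded surface without boundary. $X=X(x,t)$ is the (smooth) embedding vector of $M_t$ into $\mathbb{R}^3$, $\frac{d}{dt}X$ its total time derivative, and $\nu$ the outer unit normal to $M_t$. The principal curvatures $\lambda_1,\lambda_2$ are the eigenvalues of the second fundamental form with respect to the induced metric, with sign such that round spheres have positive principal curvatures. A surface is strictly convex if all its principal curvatures are strictly positive. $H=\lambda_1+\lambda_2$ and $|A|^2=\lambda_1^2+\lambda_2^2$. *)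

(* Defs.v *)
From mathcomp Require Export all_boot all_order all_algebra.
From mathcomp Require Export all_classical all_reals all_analysis.
Export Order.TTheory GRing.Theory Num.Theory.
Export numFieldNormedType.Exports.

Set Implicit Arguments.
Unset Strict Implicit.
Unset Printing Implicit Defensive.

#[export] Set Implicit Arguments.
#[export] Unset Strict Implicit.
#[export] Unset Printing Implicit Defensive.

Local Open Scope classical_set_scope.
Local Open Scope ring_scope.

(* C^k on an open set U of a finite-dimensional space V: all directional
   derivatives exist on U and are C^(k-1). *)
Fixpoint Ck (R : realType) (V W : normedModType R) (U : set V) (k : nat)
    (f : V -> W) : Prop :=
  (forall x, U x -> {for x, continuous f}) /\
  match k with
  | 0%N => True
  | k'.+1 => forall v : V, (forall x, U x -> derivable f x v) /\
                           Ck U k' (fun x => 'D_v f x)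
  end.

(* S is an arbitrary set: f is smooth on S when it extends, near each point of
   S, to a C^oo function on an open set.  For S = U `*` [0, T) this is
   smoothness up to and including the initial time. *)
Definition smooth_on (R : realType) (V W : normedModType R) (S : set V)
    (f : V -> W) : Prop :=
  forall x, S x -> exists (O : set V) (g : V -> W),
    [/\ open O, O x, (forall k, Ck O k g) &
        forall y, S y -> O y -> g y = f y].

(* Local parametrizations: [par] is only meaningful on [dom]. *)
Record chart (R : realType) (M : topologicalType) := Chart {
  dom : set 'rV[R]_2 ;
  par :> 'rV[R]_2 -> M }.

Definition is_chart (R : realType) (M : topologicalType) (c : chart R M) :=
  [/\ open (dom c), {within dom c, continuous c}, set_inj (dom c) c &
      forall O : set 'rV[R]_2, open O -> O `<=` dom c -> open (c @` O)].

Definition smooth_transition (R : realType) (M : topologicalType)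
    (c d : chart R M) : Prop :=
  let S := dom c `&` c @^-1` (d @` dom d) in
  exists2 theta : 'rV[R]_2 -> 'rV[R]_2, smooth_on S theta &
    forall u, S u -> dom d (theta u) /\ d (theta u) = c u.

Definition smooth_atlas (R : realType) (M : topologicalType)
    (A : set (chart R M)) : Prop :=
  [/\ forall c, A c -> is_chart c,
      forall x : M, exists2 c, A c & (c @` dom c) x &
      forall c d, A c -> A d -> smooth_transition c d].

(* Second countability follows from compactness; there is no boundary since
   charts are modelled on open subsets of the plane. *)
Definition closed_surface (R : realType) (M : topologicalType)
    (A : set (chart R M)) : Prop :=
  smooth_atlas A /\
  [/\ hausdorff_space M, [set: M] !=set0, compact [set: M] &
      connected [set: M]].

(* The library norm on row vectors is the sup norm, hence the explicit
   Euclidean product. *)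
Definition dot (R : realType) (n : nat) (u v : 'rV[R]_n) : R :=
  \sum_(i < n) u 0 i * v 0 i.

Definition pderiv (R : realType) (i : 'I_2) (Z : 'rV[R]_2 -> 'rV[R]_3)
  : 'rV[R]_2 -> 'rV[R]_3 := fun u => 'D_(delta_mx 0 i) Z u.

Definition first_form (R : realType) (Z : 'rV[R]_2 -> 'rV[R]_3)
    (u : 'rV[R]_2) : 'M[R]_2 :=
  \matrix_(i, j) dot (pderiv i Z u) (pderiv j Z u).

(* The sign makes round spheres positively curved for the outer normal n. *)
Definition second_form (R : realType) (Z : 'rV[R]_2 -> 'rV[R]_3)
    (n : 'rV[R]_3) (u : 'rV[R]_2) : 'M[R]_2 :=
  \matrix_(i, j) - dot (pderiv i (pderiv j Z) u) n.

(* l1, l2 are the eigenvalues, with multiplicity, of the second fundamental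
   form with respect to the induced metric at the point x of Y(M). *)
Definition principal_curvatures (R : realType) (M : topologicalType)
    (A : set (chart R M)) (Y : M -> 'rV[R]_3) (x : M) (n : 'rV[R]_3)
    (l1 l2 : R) : Prop :=
  forall c u, A c -> dom c u -> c u = x ->
    char_poly (second_form (Y \o c) n u *m invmx (first_form (Y \o c) u)) =
    ('X - l1%:P) * ('X - l2%:P).

(* Smoothness is part of smooth_family below; on a compact surface an injective
   immersion is automatically a homeomorphism onto its image. *)
Definition embedding (R : realType) (M : topologicalType)
    (A : set (chart R M)) (Y : M -> 'rV[R]_3) : Prop :=
  injective Y /\
  forall c u, A c -> dom c u ->
    row_free (\matrix_(i < 2) pderiv i (Y \o c) u).

(* Union of the unbounded components of the complement of K. *)
Definition exterior (R : realType) (K : set 'rV[R]_3) : set 'rV[R]_3 :=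
  [set q | exists C : set 'rV[R]_3,
     [/\ connected C, C `<=` ~` K, ~ bounded_set C & C q]].

Definition outer_unit_normal (R : realType) (M : topologicalType)
    (A : set (chart R M)) (Y : M -> 'rV[R]_3) (x : M) (n : 'rV[R]_3) : Prop :=
  [/\ dot n n = 1,
      forall c u i, A c -> dom c u -> c u = x ->
        dot (pderiv i (Y \o c) u) n = 0 &
      \forall s \near 0^'+, exterior (range Y) (Y x + s *: n)].

(* [0, T), with T = +oo allowed. *)
Definition times (R : realType) (T : \bar R) : set R :=
  [set t | 0 <= t /\ (t%:E < T)%E].

Definition smooth_family (R : realType) (M : topologicalType)
    (A : set (chart R M)) (I : set R) (X : M -> R -> 'rV[R]_3) : Prop :=
  forall c, A c ->
    smooth_on (dom c `*` I) (fun w : 'rV[R]_2 * R => X (c w.1) w.2).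

(* Derivative within I, so one-sided at the initial time. *)
Definition has_velocity (R : realType) (I : set R) (p : R -> 'rV[R]_3) (t : R)
    (v : 'rV[R]_3) : Prop :=
  (s - t)^-1 *: (p s - p t) @[s --> within I t^'] --> v.

Definition is_max (R : realType) (S : set R) (m : R) : Prop :=
  S m /\ ubound S m.

(* Main.v *)
Require Import Defs.
From mathcomp Require Import ring lra.

Local Open Scope classical_set_scope.
Local Open Scope ring_scope.

(** Write H, K for the sum and the product of the principal curvatures.  The
quantity of the theorem is w = H (H^2 - 4 K) / (2 K), the speed is
F = (1 + beta) H^2 - 2 K, and the claim is a parabolic maximum principle: at a
spatial maximum of w the time derivative of w is nonpositive.

Fix such a point, take orthonormal axes E1, E2 along the principal directions
and N = - nu, and let x, y, z be the corresponding coordinates of the moving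
embedding.  Near the point the surface is the graph of z over the (x, y)-plane.
This is used without inverting the coordinate change: by Cramer's rule the
partial derivatives D1, D2 with respect to x, y and the time derivative D0 at
fixed (x, y) are derivations of the ring of smooth functions of the chart
variables and time, with coefficients built from the derivatives of x and y.
They commute, because a commutator has no component along time, kills x and y,
and dx, dy are independent ([vfield_comm]).  With p = D1 z, q = D2 z, r = D1 p,
s = D2 p, t = D2 q and v = sqrt (1 + p^2 + q^2), one has H v^3 =
(1 + q^2) r - 2 p q s + (1 + p^2) t and K v^4 = r t - s^2
([graph_curvatures]), and the flow becomes the scalar equation D0 z = F v.

At the chosen point p = q = s = 0, r = a and t = b are the principal
curvatures, and the Leibniz rule gives H_ii and K_ii in terms of second
derivatives of r, t, as well as D0 r = F_11 + F a^2, D0 t = F_22 + F b^2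
([graph_jets]).  Since second derivatives of z are used, r_22 = t_11 is exact
and takes over the role of the Codazzi equations and of Simons' identity.
Substituting, D0 w - (2 a + 2 beta H) w_11 - (2 b + 2 beta H) w_22 contains no
fourth derivatives of z; if a <> b, the conditions w_1 = w_2 = 0 determine the
ratios r_1 : t_1 and r_2 : t_2, and the difference becomes a nonpositive
multiple of (a - b)^2 plus two multiples of squares.  Their coefficients are
affine in beta and nonpositive at beta = 0 and at beta = 5
([gradient_term_le0], [pinching_jet_le0]).  If a = b, both partial derivatives
of w with respect to a and b vanish and so does D0 w.

The normal is only given pointwise, up to a sign that could a priori jump.
The graph formulas yield the given curvatures up to a common sign, and H > 0
on both sides forces this sign to be 1 near the point ([local_pinching]).

Finally, for e > 0 the continuous function w - e t on the compact slab
M * [s, t1] has a maximum.  At a maximum with time > s, the first part gives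
w_t <= 0, whereas going back in time shows w_t >= e ([slab_max_initial]).  So
the maximum lies at time s, and e -> 0 gives the theorem. *)

(** * Differential calculus of C^k and smooth functions *)

Section Smooth.
Context {R : realType} {V : normedModType R}.
Implicit Types (W : normedModType R) (O : set V) (f g : V -> R).

Definition smooth W O (f : V -> W) := forall k, Ck O k f.

Lemma Ck_continuous W O k (f : V -> W) x :
  Ck O k f -> O x -> {for x, continuous f}.
Proof. by case: k => [|k] [h _]; exact: h. Qed.

Lemma CkS_Ck W O k (f : V -> W) : Ck O k.+1 f -> Ck O k f.
Proof.
elim: k f => [|k IH] f [hc hd]; split => // v.
by have [h1 h2] := hd v; split => //; exact: IH.
Qed.

Lemma Ck_subset W O O' k (f : V -> W) : O' `<=` O -> Ck O k f -> Ck O' k f.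
Proof.
move=> sO; elim: k f => [|k IH] f [hc hd]; split => //.
- by move=> x /sO; exact: hc.
- by move=> x /sO; exact: hc.
- move=> v; have [h1 h2] := hd v; split; last exact: IH.
  by move=> x /sO; exact: h1.
Qed.

Lemma open_near_eq W O (f g : V -> W) x :
  open O -> {in O, f =1 g} -> O x -> \forall y \near x, f y = g y.
Proof.
move=> oO fg Ox; have : nbhs x O by exact: open_nbhs_nbhs.
by apply: filterS => y Oy; apply: fg; rewrite inE.
Qed.

Lemma near_eq_continuous W (f g : V -> W) x :
  (\forall y \near x, f y = g y) -> {for x, continuous f} -> {for x, continuous g}.
Proof.
move=> fg fx; have E : f x = g x := nbhs_singleton fg.
have : g @ x --> f x.
  apply: cvg_trans fx; apply: near_eq_cvg; exact: fg.
by rewrite E.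
Qed.

Lemma eq_on_derive W O (f g : V -> W) v :
  open O -> {in O, f =1 g} -> {in O, 'D_v f =1 'D_v g}.
Proof.
move=> oO fg x; rewrite inE => Ox.
exact: near_eq_derive (open_near_eq oO fg Ox).
Qed.

Lemma Ck_eq_on W O k (f g : V -> W) :
  open O -> {in O, f =1 g} -> Ck O k f -> Ck O k g.
Proof.
move=> oO; elim: k f g => [|k IH] f g fg [hc hd].
  by split=> // x Ox; exact: near_eq_continuous (open_near_eq oO fg Ox) (hc x Ox).
split=> [x Ox|v].
  exact: near_eq_continuous (open_near_eq oO fg Ox) (hc x Ox).
have [h1 h2] := hd v; split.
  move=> x Ox; apply: near_eq_derivable (h1 x Ox); exact: (open_near_eq oO fg Ox).
by apply: IH h2; exact: eq_on_derive.
Qed.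

Lemma Ck_cst W O k (c : W) : open O -> Ck O k (cst c).
Proof.
move=> oO; elim: k c => [|k IH] c; split => //.
- by move=> x _; exact: cst_continuous.
- by move=> x _; exact: cst_continuous.
- move=> v; split; first by move=> x _; exact: derivable_cst.
  apply: (Ck_eq_on oO _ (IH 0)) => x _.
  by rewrite /= derive_cst.
Qed.

Lemma Ck_add O k f g : open O -> Ck O k f -> Ck O k g -> Ck O k (f \+ g).
Proof.
move=> oO; elim: k f g => [|k IH] f g Cf Cg; case: Cf => cf df; case: Cg => cg dg; split.
- by move=> x Ox; apply: cvgD; [exact: cf | exact: cg].
- exact: I.
- by move=> x Ox; apply: cvgD; [exact: cf | exact: cg].
- move=> v; have [f1 f2] := df v; have [g1 g2] := dg v; split.
    by move=> x Ox; apply: derivableD; [exact: f1|exact: g1].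
  apply: (Ck_eq_on oO _ (IH _ _ f2 g2)) => x; rewrite inE => Ox /=.
  by rewrite deriveD //; [exact: f1|exact: g1].
Qed.

Lemma Ck_mul O k f g : open O -> Ck O k f -> Ck O k g -> Ck O k (f \* g).
Proof.
move=> oO; elim: k f g => [|k IH] f g Cf Cg.
  case: Cf => cf _; case: Cg => cg _; split; [|exact: I] => x Ox.
  by apply: cvgM; [exact: cf | exact: cg].
have [cf df] := Cf; have [cg dg] := Cg.
split; first by move=> x Ox; apply: cvgM; [exact: cf | exact: cg].
move=> v; have [f1 f2] := df v; have [g1 g2] := dg v; split.
  by move=> x Ox; apply: derivableM; [exact: f1|exact: g1].
apply: (Ck_eq_on oO _ (Ck_add oO (IH _ _ (CkS_Ck Cf) g2)
  (IH _ _ (CkS_Ck Cg) f2))) => x; rewrite inE => Ox /=.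
by rewrite deriveM //; [exact: f1|exact: g1].
Qed.

(** Induction on k works because the derivative is again built from the inverse:
D (1/f) = - (1/f)^2 D f. *)
Lemma Ck_inv O k f : open O -> (forall x, O x -> f x != 0) ->
  Ck O k f -> Ck O k (fun x => (f x)^-1).
Proof.
move=> oO f0; elim: k => [|k IH] Cf.
  case: Cf => cf _; split; [|exact: I] => x Ox.
  by apply: cvgV; [exact: f0 | exact: cf].
have [cf df] := Cf.
split; first by move=> x Ox; apply: cvgV; [exact: f0 | exact: cf].
move=> v; have [f1 f2] := df v; split.
  by move=> x Ox; apply: derivableV; [exact: f0|exact: f1].
have Ci := IH (CkS_Ck Cf).
have Cm := Ck_mul oO (Ck_mul oO (Ck_cst k (-1 : R) oO) (Ck_mul oO Ci Ci)) f2.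
apply: (Ck_eq_on oO _ Cm) => x; rewrite inE => Ox /=.
rewrite deriveV //; [|exact: f0|exact: f1].
by rewrite /cst scaleNr mulN1r mulNr -invfM -expr2.
Qed.

(** Directional derivatives are derivatives of functions of one real variable,
which gives access to the mean value theorem and to the chain rule. *)
Lemma is_derive_line W (f : V -> W) x v (s : R) : derivable f (x + s *: v) v ->
  is_derive s 1 (fun u : R => f (x + u *: v)) ('D_v f (x + s *: v)).
Proof.
have E : (fun h : R => h^-1 *: (((fun u : R => f (x + u *: v)) \o shift s) (h *: 1)
     - f (x + s *: v))) =
   (fun h => h^-1 *: ((f \o shift (x + s *: v)) (h *: v) - f (x + s *: v))).
  apply/funext => h /=.
  by rewrite [h *: 1]mulr1 scalerDl addrCA.
move=> df; apply: DeriveDef.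
  by rewrite /derivable E.
by rewrite /derive E.
Qed.

Lemma is_derive_of_line W (f : V -> W) x v d :
  is_derive (0 : R) (1 : R) (fun u : R => f (x + u *: v)) d -> is_derive x v f d.
Proof.
have E : (fun h : R => h^-1 *: (((fun u : R => f (x + u *: v)) \o shift (0 : R))
     (h *: (1 : R)) - (fun u : R => f (x + u *: v)) (0 : R))) =
   (fun h => h^-1 *: ((f \o shift x) (h *: v) - f x)).
  apply/funext => h /=.
  by rewrite [h *: 1]mulr1 addr0 scale0r addr0 [x + _]addrC.
by case; rewrite /derivable /derive E => h1 h2; apply: DeriveDef.
Qed.

Lemma is_derive_sqrt f x v : 0 < f x -> derivable f x v ->
  is_derive x v (fun y => Num.sqrt (f y)) ((2 * Num.sqrt (f x))^-1 * 'D_v f x).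
Proof.
move=> f0 df; apply: is_derive_of_line.
have df0 : derivable f (x + (0 : R) *: v) v by rewrite scale0r addr0.
have f00 : 0 < f (x + (0 : R) *: v) by rewrite scale0r addr0.
have := is_derive1_comp (is_derive1_sqrt f00) (is_derive_line df0).
by rewrite scale0r addr0.
Qed.

Lemma Ck_sqrt O k f : open O -> (forall x, O x -> 0 < f x) ->
  Ck O k f -> Ck O k (fun x => Num.sqrt (f x)).
Proof.
move=> oO f0; elim: k => [|k IH] Cf.
  case: Cf => cf _; split; [|exact: I] => x Ox.
  by apply: continuous_comp; [exact: cf | exact: sqrt_continuous].
have [cf df] := Cf.
split.
  move=> x Ox.
  by apply: continuous_comp; [exact: cf | exact: sqrt_continuous].
move=> v; have [f1 f2] := df v; split.
  by move=> x Ox; have [] := is_derive_sqrt (f0 _ Ox) (f1 _ Ox).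
have Ci := IH (CkS_Ck Cf).
have Ci2 : Ck O k (fun x => (2 * Num.sqrt (f x))^-1).
  apply: Ck_inv => //.
    by move=> x Ox; rewrite mulf_neq0 ?pnatr_eq0 // gt_eqF // sqrtr_gt0 f0.
  exact: (Ck_mul oO (Ck_cst k (2 : R) oO) Ci).
apply: (Ck_eq_on oO _ (Ck_mul oO Ci2 f2)) => x; rewrite inE => Ox /=.
by have [_ ->] := is_derive_sqrt (f0 _ Ox) (f1 _ Ox).
Qed.

Lemma Ck_coord n O k (f : V -> 'rV[R]_n) i : open O ->
  Ck O k f -> Ck O k (fun x => f x 0 i).
Proof.
move=> oO; elim: k f => [|k IH] f [cf df]; split=> //.
- move=> x Ox; apply: (@continuous_comp _ _ _ f (fun M : 'rV_n => M 0 i)).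
    exact: cf.
  exact: coord_continuous.
- move=> x Ox; apply: (@continuous_comp _ _ _ f (fun M : 'rV_n => M 0 i)).
    exact: cf.
  exact: coord_continuous.
- move=> v; have [f1 f2] := df v; split.
    by move=> x Ox; have /derivable_mxP := f1 x Ox; exact.
  apply: (Ck_eq_on oO _ (IH _ f2)) => x; rewrite inE => Ox /=.
  by rewrite derive_mx ?mxE //; exact: f1.
Qed.

End Smooth.

Section SmoothFunctions.
Context {R : realType} {V : normedModType R}.
Implicit Types (W : normedModType R) (O : set V) (f g : V -> R).

Lemma smooth_continuous W O (f : V -> W) x :
  smooth O f -> O x -> {for x, continuous f}.
Proof. by move=> sf; exact: Ck_continuous (sf 0%N). Qed.

Lemma smooth_derivable W O (f : V -> W) x v : smooth O f -> O x -> derivable f x v.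
Proof. by move=> sf; have [_ /(_ v)[h _]] := sf 1%N; exact: h. Qed.

Lemma smooth_derive W O (f : V -> W) v : smooth O f -> smooth O ('D_v f).
Proof. by move=> sf k; have [_ /(_ v)[_]] := sf k.+1. Qed.

Lemma smooth_subset W O O' (f : V -> W) : O' `<=` O -> smooth O f -> smooth O' f.
Proof. by move=> sO sf k; exact: Ck_subset sO (sf k). Qed.

Lemma smooth_eq_on W O (f g : V -> W) :
  open O -> {in O, f =1 g} -> smooth O f -> smooth O g.
Proof. by move=> oO fg sf k; exact: Ck_eq_on oO fg (sf k). Qed.

Lemma smooth_cst W O (c : W) : open O -> smooth O (fun=> c).
Proof. by move=> oO k; exact: Ck_cst. Qed.

Lemma smooth_add O f g : open O -> smooth O f -> smooth O g -> smooth O (f \+ g).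
Proof. by move=> oO sf sg k; exact: Ck_add. Qed.

Lemma smooth_mul O f g : open O -> smooth O f -> smooth O g -> smooth O (f \* g).
Proof. by move=> oO sf sg k; exact: Ck_mul. Qed.

Lemma smooth_opp O f : open O -> smooth O f -> smooth O (fun x => - f x).
Proof.
move=> oO sf; apply: (smooth_eq_on oO _ (smooth_mul oO (smooth_cst (-1 : R) oO) sf)).
by move=> x _ /=; rewrite mulN1r.
Qed.

Lemma smooth_inv O f : open O -> (forall x, O x -> f x != 0) ->
  smooth O f -> smooth O (fun x => (f x)^-1).
Proof. by move=> oO f0 sf k; exact: Ck_inv. Qed.

Lemma smooth_sqrt O f : open O -> (forall x, O x -> 0 < f x) ->
  smooth O f -> smooth O (fun x => Num.sqrt (f x)).
Proof. by move=> oO f0 sf k; exact: Ck_sqrt. Qed.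

Lemma smooth_coord n O (f : V -> 'rV[R]_n) i : open O ->
  smooth O f -> smooth O (fun x => f x 0 i).
Proof. by move=> oO sf k; exact: Ck_coord. Qed.

Lemma smooth_sum n O (F : 'I_n -> V -> R) : open O ->
  (forall i, smooth O (F i)) -> smooth O (fun x => \sum_i F i x).
Proof.
move=> oO sF.
elim: n F sF => [|n IH] F sF.
  by apply: (smooth_eq_on oO _ (smooth_cst (0 : R) oO)) => x _; rewrite big_ord0.
have S := smooth_add oO (IH (fun i => F (widen_ord (leqnSn n) i)) (fun i => sF _))
  (sF ord_max).
by apply: (smooth_eq_on oO _ S) => x _; rewrite big_ord_recr.
Qed.

Lemma nbhs_plane x v w (P : V -> Prop) : nbhs x P ->
  exists2 d : R, 0 < d & forall s t, `|s| <= d -> `|t| <= d -> P (x + (s *: v + t *: w)).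
Proof.
move=> /nbhs_ballP[e e0 He].
have k0 : 0 < `|v| + `|w| + 1 by rewrite ltr_wpDl // addr_ge0.
exists (e / (`|v| + `|w| + 1)); first by rewrite divr_gt0.
move=> s t hs ht; apply: He; rewrite -ball_normE /ball_ /=.
rewrite opprD addrA subrr sub0r normrN.
apply: le_lt_trans (ler_normD _ _) _; rewrite !normrZ.
have d0 : 0 < e / (`|v| + `|w| + 1) by rewrite divr_gt0.
have Ed : e = e / (`|v| + `|w| + 1) * (`|v| + `|w| + 1) by rewrite divfK // gt_eqF.
rewrite {}[X in _ < X]Ed; move: (e / _) d0 hs ht => d d0 hs ht.
rewrite !mulrDr mulr1.
apply: (@le_lt_trans _ _ (d * `|v| + d * `|w|)); last by rewrite ltrDl.
by apply: lerD; apply: ler_wpM2r.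
Qed.

Lemma line_mvt_oo O f x v (h : R) : smooth O f -> 0 < h ->
  (forall s : R, 0 <= s <= h -> O (x + s *: v)) ->
  exists2 s, 0 < s < h & f (x + h *: v) - f x = h * 'D_v f (x + s *: v).
Proof.
move=> sf h0 HO.
have [||s] := @MVT R (fun u => f (x + u *: v)) (fun s => 'D_v f (x + s *: v)) 0 h h0.
- move=> s; rewrite in_itv /= => /andP[s0 sh].
  apply: (@is_derive_line _ _ _ f x v s); apply: (smooth_derivable sf (HO s _)).
  by rewrite !ltW.
- apply: derivable_within_continuous => s; rewrite in_itv /= => sh.
  have [] // := @is_derive_line _ _ _ f x v s.
  exact: (smooth_derivable sf (HO s _)).
rewrite in_itv /= => /andP[s0 sh]; rewrite scale0r addr0 subr0 => ->.
by exists s; rewrite ?s0 // mulrC.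
Qed.

Lemma line_mvt O f x v (h : R) : smooth O f -> 0 < h ->
  (forall s : R, 0 <= s <= h -> O (x + s *: v)) ->
  exists2 s, 0 <= s <= h & f (x + h *: v) - f x = h * 'D_v f (x + s *: v).
Proof.
move=> sf h0 HO; have [s /andP[s0 sh] E] := line_mvt_oo sf h0 HO.
by exists s; rewrite ?ltW.
Qed.

Lemma eq_of_dist_le (a b : R) : (forall e, 0 < e -> `|a - b| <= e) -> a = b.
Proof.
move=> H; apply/eqP; rewrite -subr_eq0 -normr_eq0; apply/eqP/le_anti.
rewrite normr_ge0 andbT; apply/ler_addgt0Pl => e e0.
by rewrite addr0; exact: H.
Qed.

Lemma dist_add_lt (e a b c b' c' : R) :
  `|b - b'| < e / 3 -> `|c - c'| < e / 3 -> `|a - (c' + b')| < e / 3 ->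
  `|a - (b + c)| <= e.
Proof.
rewrite !ltr_norml ler_norml => /andP[? ?] /andP[? ?] /andP[? ?].
by apply/andP; split; lra.
Qed.

Lemma dist_mid_le (e a b c : R) :
  `|a - c| < e / 2 -> `|b - c| < e / 2 -> `|a - b| <= e.
Proof.
rewrite !ltr_norml ler_norml => /andP[? ?] /andP[? ?].
by apply/andP; split; lra.
Qed.

(** A directional derivative need not be additive in the direction; for C^1
functions it is, by the mean value theorem along the two sides of a small
parallelogram. *)
Lemma derive_addv O f x v w : open O -> smooth O f -> O x ->
  'D_(v + w) f x = 'D_v f x + 'D_w f x.
Proof.
move=> oO sf Ox; apply: eq_of_dist_le => e e0.
have e3 : 0 < e / 3 by rewrite divr_gt0.
have := smooth_derivable (v := v + w) sf Ox.
have cv : {for x, continuous ('D_v f)} := smooth_continuous (smooth_derive v sf) Ox.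
have cw : {for x, continuous ('D_w f)} := smooth_continuous (smooth_derive w sf) Ox.
have NO : nbhs x O by exact: open_nbhs_nbhs.
have Nv : nbhs x [set y | `|'D_v f x - 'D_v f y| < e / 3].
  by move/cvgrPdist_lt : cv; apply.
have Nw : nbhs x [set y | `|'D_w f x - 'D_w f y| < e / 3].
  by move/cvgrPdist_lt : cw; apply.
have [d d0 Hd] := nbhs_plane v w (filterI NO (filterI Nv Nw)).
move=> /cvgrPdist_lt /(_ _ e3) /= [d' /= d'0 Hd'].
pose h := Num.min d (d' / 2).
have h0 : 0 < h by rewrite lt_min d0 divr_gt0.
have hd : h <= d by rewrite ge_min lexx.
have hd' : h < d'.
  by rewrite gt_min; apply/orP; right; rewrite ltr_pdivrMr // mulr_natr mulr2n ltrDl.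
have := Hd' h; rewrite /= sub0r normrN gtr0_norm // => /(_ hd').
rewrite gt_eqF // => /(_ isT).
rewrite -/('D_(v + w) f x).
have D s t : 0 <= s <= h -> 0 <= t <= h -> O (x + (s *: v + t *: w)) /\
   `|'D_v f x - 'D_v f (x + (s *: v + t *: w))| < e / 3 /\
   `|'D_w f x - 'D_w f (x + (s *: v + t *: w))| < e / 3.
  move=> /andP[s0 sh] /andP[t0 th].
  have := Hd s t; rewrite (ger0_norm s0) (ger0_norm t0).
  move=> /(_ (le_trans sh hd) (le_trans th hd)) [H1 [H2 H3]]; exact: (conj H1 (conj H2 H3)).
have hh : 0 <= h <= h by rewrite lexx ltW.
have h00 : 0 <= (0 : R) <= h by rewrite lexx ltW.
have [|s hs Es] := line_mvt sf h0 (x := x) (v := v).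
  move=> s hs; have [+ _] := D s 0 hs h00.
  by rewrite scale0r addr0.
have [|t ht Et] := line_mvt sf h0 (x := x + h *: v) (v := w).
  move=> t ht; have [+ _] := D h t hh ht.
  by rewrite addrA.
have [_ [Ds _]] := D s 0 hs h00.
have [_ [_ Dt]] := D h t hh ht.
rewrite scale0r addr0 in Ds; rewrite addrA in Dt.
have -> : f (h *: (v + w) + x) - f x = h * ('D_w f (x + h *: v + t *: w) + 'D_v f (x + s *: v)).
  have -> : h *: (v + w) + x = x + h *: v + h *: w by rewrite scalerDr addrC addrA.
  by rewrite mulrDr -Es -Et; ring.
rewrite [_^-1 *: _]mulKf ?gt_eqF //.
exact: dist_add_lt Ds Dt.
Qed.

Lemma derive_scalev O f x (a : R) v : open O -> smooth O f -> O x ->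
  'D_(a *: v) f x = a * 'D_v f x.
Proof.
move=> oO sf Ox.
pose ph (u : R) : R := a * u.
apply: (@derive_val _ _ _ _ _ _ _ _); apply: is_derive_of_line.
have dfa : derivable f (x + ph 0 *: v) v.
  by rewrite /ph mulr0 scale0r addr0; exact: smooth_derivable sf Ox.
have H1 := is_derive_line dfa.
have H2 : is_derive (0 : R) (1 : R) ph a.
  have := @is_deriveM _ _ (cst a) id (0 : R) (1 : R) 0 1 _ _.
  move=> H; apply: is_derive_eq (H _ _) _ => //=.
  by rewrite scaler0 addr0 /cst [a *: _]mulr1.
have := is_derive1_comp H1 H2.
rewrite /ph mulr0 scale0r addr0 mulrC.
by congr (is_derive _ _ _ _); apply/funext => u /=; rewrite scalerA mulrC.
Qed.

(** Applying the mean value theorem once in each direction; exchanging v and w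
leaves the left-hand side invariant, whence the symmetry of second derivatives. *)
Lemma second_difference O f x v w (h : R) : smooth O f -> 0 < h ->
  (forall s t : R, 0 <= s <= h -> 0 <= t <= h -> O (x + (s *: v + t *: w))) ->
  open O ->
  exists s t, [/\ 0 <= s <= h, 0 <= t <= h &
    f (x + (h *: v + h *: w)) - f (x + h *: v) - (f (x + h *: w) - f x) =
    h * (h * 'D_w ('D_v f) (x + (s *: v + t *: w)))].
Proof.
move=> sf h0 HO oO.
have hh : 0 <= h <= h by rewrite lexx ltW.
have h00 : 0 <= (0 : R) <= h by rewrite lexx ltW.
have HO0 s : 0 <= s <= h -> O (x + s *: v).
  by move=> hs; have := HO s 0 hs h00; rewrite scale0r addr0.
have HOh s : 0 <= s <= h -> O (x + h *: w + s *: v).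
  by move=> hs; have := HO s h hs hh; rewrite [s *: v + _]addrC addrA.
have [||s] := @MVT R (fun u => f (x + h *: w + u *: v) - f (x + u *: v))
   (fun s => 'D_v f (x + h *: w + s *: v) - 'D_v f (x + s *: v)) 0 h h0.
- move=> s; rewrite in_itv /= => /andP[s0 sh].
  have hs : 0 <= s <= h by rewrite !ltW.
  apply: is_deriveB.
    apply: (@is_derive_line _ _ _ f (x + h *: w) v s); exact: (smooth_derivable sf (HOh s _)).
  apply: (@is_derive_line _ _ _ f x v s); exact: (smooth_derivable sf (HO0 s _)).
- apply: derivable_within_continuous => s; rewrite in_itv /= => sh.
  apply: derivableB.
    have [] // := @is_derive_line _ _ _ f (x + h *: w) v s.
    exact: (smooth_derivable sf (HOh s _)).
  have [] // := @is_derive_line _ _ _ f x v s.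
  exact: (smooth_derivable sf (HO0 s _)).
rewrite in_itv /= => /andP[s0 sh]; rewrite !scale0r !addr0 subr0 => Es.
have hs : 0 <= s <= h by rewrite !ltW.
have [|t ht Et] := line_mvt (smooth_derive v sf) h0 (x := x + s *: v) (v := w).
  by move=> t ht; rewrite -addrA; exact: HO.
exists s, t; split=> //.
have -> : x + (s *: v + t *: w) = x + s *: v + t *: w by rewrite addrA.
have E1 : x + h *: w + s *: v = x + s *: v + h *: w by rewrite addrAC.
have -> : x + (h *: v + h *: w) = x + h *: w + h *: v by rewrite addrA addrAC.
rewrite -Et; rewrite E1 in Es; rewrite [RHS]mulrC -Es.
by rewrite !opprB addrACA [- f (x + h *: v) + _]addrC addrACA.
Qed.

Lemma derive_comm O f x v w : open O -> smooth O f -> O x ->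
  'D_w ('D_v f) x = 'D_v ('D_w f) x.
Proof.
move=> oO sf Ox; apply: eq_of_dist_le => e e0.
have e3 : 0 < e / 2 by rewrite divr_gt0.
have cv : {for x, continuous ('D_w ('D_v f))} :=
  smooth_continuous (smooth_derive w (smooth_derive v sf)) Ox.
have cw : {for x, continuous ('D_v ('D_w f))} :=
  smooth_continuous (smooth_derive v (smooth_derive w sf)) Ox.
have NO : nbhs x O by exact: open_nbhs_nbhs.
have Nv : nbhs x [set y | `|'D_w ('D_v f) x - 'D_w ('D_v f) y| < e / 2].
  by move/cvgrPdist_lt : cv; apply.
have Nw : nbhs x [set y | `|'D_v ('D_w f) x - 'D_v ('D_w f) y| < e / 2].
  by move/cvgrPdist_lt : cw; apply.
have [h h0 Hd] := nbhs_plane v w (filterI NO (filterI Nv Nw)).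
have D s t : 0 <= s <= h -> 0 <= t <= h -> O (x + (s *: v + t *: w)) /\
   `|'D_w ('D_v f) x - 'D_w ('D_v f) (x + (s *: v + t *: w))| < e / 2 /\
   `|'D_v ('D_w f) x - 'D_v ('D_w f) (x + (s *: v + t *: w))| < e / 2.
  move=> /andP[s0 sh] /andP[t0 th].
  have := Hd s t; rewrite (ger0_norm s0) (ger0_norm t0).
  move=> /(_ sh th) [H1 [H2 H3]]; exact: (conj H1 (conj H2 H3)).
have [|s [t [hs ht E1]]] := second_difference (x := x) (v := v) (w := w) sf h0 _ oO.
  by move=> s t hs ht; have [] := D s t hs ht.
have [|s' [t' [hs' ht' E2]]] := second_difference (x := x) (v := w) (w := v) sf h0 _ oO.
  by move=> s' t' hs' ht'; rewrite [s' *: _ + _]addrC; have [] := D t' s' ht' hs'.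
have [_ [D1 _]] := D _ _ hs ht.
have [_ [_ D2]] := D _ _ ht' hs'.
have E : 'D_w ('D_v f) (x + (s *: v + t *: w)) = 'D_v ('D_w f) (x + (t' *: v + s' *: w)).
  have hn : h != 0 by rewrite gt_eqF.
  apply: (mulfI hn); apply: (mulfI hn).
  rewrite [s' *: _ + _]addrC [h *: w + _]addrC in E2.
  refine (etrans (esym E1) (etrans _ E2)).
  by rewrite !opprB addrACA [- f (x + h *: v) + _]addrC addrACA.
rewrite E in D1; exact: dist_mid_le D1 D2.
Qed.

Lemma nbhs_line x v (P : V -> Prop) : nbhs x P ->
  exists2 d : R, 0 < d & forall s, 0 <= s <= d -> P (x + s *: v).
Proof.
move=> /(nbhs_plane v 0)[d d0 H]; exists d => // s /andP[s0 sd].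
have := H s 0; rewrite scale0r addr0; apply; first by rewrite ger0_norm.
by rewrite normr0 ltW.
Qed.

(** The maximality conditions below are one-sided, along a ray: this is the form
in which the geometry provides them. *)
Lemma derive_le0_ray_max O f x v : open O -> smooth O f -> O x ->
  (exists2 d : R, 0 < d & forall s, 0 <= s <= d -> f (x + s *: v) <= f x) ->
  'D_v f x <= 0.
Proof.
move=> oO sf Ox [d d0 Hd]; rewrite leNgt; apply/negP => D0.
have cD : {for x, continuous ('D_v f)} := smooth_continuous (smooth_derive v sf) Ox.
have N1 : nbhs x [set y | 0 < 'D_v f y].
  apply: (cD [set y : R | 0 < y]); apply: open_nbhs_nbhs; split; [exact: open_gt|exact: D0].
have N2 : nbhs x O by exact: open_nbhs_nbhs.
have [e e0 He] := nbhs_line v (filterI N2 N1).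
pose h := Num.min d e.
have h0 : 0 < h by rewrite lt_min d0 e0.
have hd : h <= d by rewrite ge_min lexx.
have he : h <= e by rewrite ge_min lexx orbT.
have HO s : 0 <= s <= h -> O (x + s *: v).
  by move=> /andP[s0 sh]; have [] // := He s; rewrite s0 (le_trans sh).
have [s /andP[s0 sh] E] := line_mvt sf h0 HO.
have hs : 0 <= s <= e by rewrite s0 (le_trans sh).
have [_ /= Dp] := He s hs.
have : f (x + h *: v) - f x <= 0 by rewrite subr_le0 Hd // ltW.
by rewrite E leNgt mulr_gt0.
Qed.

Lemma derive2_le0_ray_max O f x v : open O -> smooth O f -> O x ->
  (exists2 d : R, 0 < d & forall s, 0 <= s <= d -> f (x + s *: v) <= f x) ->
  'D_v f x = 0 -> 'D_v ('D_v f) x <= 0.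
Proof.
move=> oO sf Ox [d d0 Hd] D0; rewrite leNgt; apply/negP => DD0.
have sDf := smooth_derive v sf.
have cD : {for x, continuous ('D_v ('D_v f))} :=
  smooth_continuous (smooth_derive v sDf) Ox.
have N1 : nbhs x [set y | 0 < 'D_v ('D_v f) y].
  apply: (cD [set y : R | 0 < y]); apply: open_nbhs_nbhs; split; [exact: open_gt|exact: DD0].
have N2 : nbhs x O by exact: open_nbhs_nbhs.
have [e e0 He] := nbhs_line v (filterI N2 N1).
pose h := Num.min d e.
have h0 : 0 < h by rewrite lt_min d0 e0.
have hd : h <= d by rewrite ge_min lexx.
have he : h <= e by rewrite ge_min lexx orbT.
have HO s : 0 <= s <= h -> O (x + s *: v).
  by move=> /andP[s0 sh]; have [] // := He s; rewrite s0 (le_trans sh).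
have [s /andP[s0 sh] E] := line_mvt_oo sf h0 HO.
have HO' s' : 0 <= s' <= s -> O (x + s' *: v).
  by move=> /andP[s'0 s'h]; apply: HO; rewrite s'0 (le_trans s'h) // ltW.
have [s' /andP[s'0 s's] E'] := line_mvt_oo sDf s0 HO'.
have hs' : 0 <= s' <= e by rewrite ltW // (le_trans (ltW s's) (le_trans (ltW sh) he)).
have [_ /= Dp] := He s' hs'.
rewrite D0 subr0 in E'.
have : f (x + h *: v) - f x <= 0 by rewrite subr_le0 Hd // ltW.
by rewrite E leNgt mulr_gt0 // E' mulr_gt0.
Qed.

Lemma derive_eq0_ray_max O f x v : open O -> smooth O f -> O x ->
  (forall w, w = v \/ w = - v ->
    exists2 d : R, 0 < d & forall s, 0 <= s <= d -> f (x + s *: w) <= f x) ->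
  'D_v f x = 0.
Proof.
move=> oO sf Ox H; apply/le_anti/andP; split.
  by apply: derive_le0_ray_max oO sf Ox _; apply: H; left.
have := derive_le0_ray_max oO sf Ox (H (- v) (or_intror erefl)).
by rewrite -scaleN1r (derive_scalev _ _ oO sf Ox) mulN1r oppr_le0.
Qed.

End SmoothFunctions.

(** * The algebra of the evolution of the pinching quantity *)

Section Real.
Context {R : realType}.

(** This is the coefficient of the squared gradient in [pinching_jet_le0].  It is
affine in be, so the end points be = 0 and be = 5 suffice; at be = 5 the
coefficient of a^8 b^2 is exactly 0. *)
Lemma gradient_term_le0 (a b be : R) : 0 < a -> 0 < b -> 0 <= be <= 5 ->
  - 6*b^+10 - 16*(a*b^+9) - 68*(a^+2*b^+8) - 88*(a^+3*b^+7) - 144*(a^+4*b^+6)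
   - 96*(a^+5*b^+5) - 92*(a^+6*b^+4) + 8*(a^+7*b^+3) - 10*(a^+8*b^+2)
  + be * (- 6*b^+10 - 40*(a*b^+9) - 112*(a^+2*b^+8) - 200*(a^+3*b^+7)
    - 268*(a^+4*b^+6) - 248*(a^+5*b^+5) - 128*(a^+6*b^+4) - 24*(a^+7*b^+3)
    + 2*(a^+8*b^+2)) <= 0.
Proof.
move=> a0 b0 /andP[be0 be5].
have P (i j : nat) : 0 <= a ^+ i * b ^+ j by rewrite mulr_ge0 // exprn_ge0 // ltW.
have e1 : 2 * (a^+7*b^+3) <= a^+8*b^+2 + a^+6*b^+4.
  rewrite -subr_ge0 (_ : _ - _ = a^+6*b^+2 * (a - b)^+2); last by ring.
  by rewrite mulr_ge0 ?sqr_ge0 ?P.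
have p1 := P 1 9; have p2 := P 2 8; have p3 := P 3 7; have p4 := P 4 6.
have p5 := P 5 5; have p6 := P 6 4; have p7 := P 7 3; have p8 := P 8 2; have p10 := P 0 10.
rewrite expr1 in p1; rewrite expr0 mul1r in p10.
set E0 := (X in X + be * _); set E1 := (X in be * X).
have h0 : E0 <= 0 by rewrite /E0; lra.
have h5 : E0 + 5 * E1 <= 0 by rewrite /E0 /E1; lra.
have -> : E0 + be * E1 = (5 - be) / 5 * E0 + be / 5 * (E0 + 5 * E1) by field.
rewrite -[X in _ <= X](addr0 0) lerD // mulr_ge0_le0 // divr_ge0 //.
by rewrite subr_ge0.
Qed.

(** The hypotheses are the relations satisfied by the derivatives of a graph at a
point where its gradient vanishes and its Hessian is diag(a, b): A1, A2 and
B1, B2 are the first derivatives of the two second derivatives r, t of the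
height; r11, m, t22 are r_11, r_22 = t_11 and t_22; w is the pinching quantity,
assumed critical.  The conclusion comes from an identity expressing Wt as a
positive combination of W11 and W22 plus nonpositive terms. *)
Lemma pinching_jet_le0 (a b be w A1 A2 B1 B2 r11 m t22 W11 W22 Wt H K F
   H1 H2 K1 K2 H11 H22 K11 K22 F11 F22 rt tt Ht Kt : R) :
  0 < a -> 0 < b -> 0 <= be <= 5 ->
  H = a + b -> K = a * b -> F = (1 + be) * H ^+ 2 - 2 * K ->
  2 * (K * w) = H ^+ 3 - 4 * (H * K) ->
  H1 = A1 + B1 -> H2 = A2 + B2 ->
  K1 = A1 * b + a * B1 -> K2 = A2 * b + a * B2 ->
  H11 + 3 * H * a ^+ 2 = r11 + m + 2 * a ^+ 2 * b ->
  H22 + 3 * H * b ^+ 2 = m + t22 + 2 * b ^+ 2 * a ->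
  K11 + 4 * K * a ^+ 2 = r11 * b + 2 * (A1 * B1) + a * m - 2 * A2 ^+ 2 ->
  K22 + 4 * K * b ^+ 2 = m * b + 2 * (A2 * B2) + a * t22 - 2 * B1 ^+ 2 ->
  F11 = (1 + be) * (2 * H * H11 + 2 * H1 ^+ 2) - 2 * K11 ->
  F22 = (1 + be) * (2 * H * H22 + 2 * H2 ^+ 2) - 2 * K22 ->
  rt = F11 + F * a ^+ 2 -> tt = F22 + F * b ^+ 2 ->
  Ht = rt + tt -> Kt = rt * b + a * tt ->
  2 * (K1 * w) = 3 * H ^+ 2 * H1 - 4 * (H1 * K + H * K1) ->
  2 * (K2 * w) = 3 * H ^+ 2 * H2 - 4 * (H2 * K + H * K2) ->
  2 * (K * W11 + K11 * w) =
    3 * H ^+ 2 * H11 + 6 * H * H1 ^+ 2 - 4 * (H11 * K + 2 * (H1 * K1) + H * K11) ->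
  2 * (K * W22 + K22 * w) =
    3 * H ^+ 2 * H22 + 6 * H * H2 ^+ 2 - 4 * (H22 * K + 2 * (H2 * K2) + H * K22) ->
  2 * (K * Wt + Kt * w) = 3 * H ^+ 2 * Ht - 4 * (Ht * K + H * Kt) ->
  W11 <= 0 -> W22 <= 0 -> Wt <= 0.
Proof.
move=> a0 b0 hbe EH EK EF Ew EH1 EH2 EK1 EK2 EH11 EH22 EK11 EK22 EF11 EF22 Ert Ett
  EHt EKt c1 c2 EW11 EW22 EWt h11 h22.
have {}EH11 : H11 = r11 + m + 2 * a ^+ 2 * b - 3 * H * a ^+ 2 by rewrite -EH11 addrK.
have {}EH22 : H22 = m + t22 + 2 * b ^+ 2 * a - 3 * H * b ^+ 2 by rewrite -EH22 addrK.
have {}EK11 : K11 = r11 * b + 2 * (A1 * B1) + a * m - 2 * A2 ^+ 2 - 4 * K * a ^+ 2.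
  by rewrite -EK11 addrK.
have {}EK22 : K22 = m * b + 2 * (A2 * B2) + a * t22 - 2 * B1 ^+ 2 - 4 * K * b ^+ 2.
  by rewrite -EK22 addrK.
have be0 : 0 <= be by case/andP: hbe.
have K0 : 0 < K by rewrite EK mulr_gt0.
have a1 : a != 0 by rewrite gt_eqF.
have b1 : b != 0 by rewrite gt_eqF.
have Ew' : 2 * (K * w) = H * (a - b) ^+ 2 by rewrite Ew EH EK; ring.
have [ab|ab] := eqVneq a b.
  have w0 : w = 0.
    apply/eqP; move/eqP: Ew'; rewrite ab subrr expr0n /= mulr0.
    by rewrite !mulf_eq0 pnatr_eq0 (gt_eqF K0) /= .
  suff : 2 * K * Wt = 0.
    by move/eqP; rewrite !mulf_eq0 pnatr_eq0 (gt_eqF K0) /= => /eqP ->.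
  rewrite w0 mulr0 addr0 in EWt.
  by rewrite -mulrA EWt EHt EKt EH EK ab; ring.
have ab' : a - b != 0 by rewrite subr_eq0.
have qa : 0 < 2 * a ^+ 2 + a * b + b ^+ 2.
  by rewrite !addr_gt0 ?mulr_gt0 ?exprn_gt0 //.
have qb : 0 < 2 * b ^+ 2 + a * b + a ^+ 2.
  by rewrite !addr_gt0 ?mulr_gt0 ?exprn_gt0 //.
(* criticality of w makes the derivatives of r and t proportional *)
have kappa A B : 2 * ((A * b + a * B) * w) = 3 * H ^+ 2 * (A + B)
     - 4 * ((A + B) * K + H * (A * b + a * B)) ->
  exists2 k, A = a * (2 * b ^+ 2 + a * b + a ^+ 2) * k &
            B = b * (2 * a ^+ 2 + a * b + b ^+ 2) * k.
  move=> c.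
  have c' : K * (3 * H ^+ 2 * (A + B) - 4 * ((A + B) * K + H * (A * b + a * B)))
      - (A * b + a * B) * (H * (a - b) ^+ 2) = 0.
    by rewrite -c -Ew'; ring.
  have Z : (a - b) * (b * (2 * a ^+ 2 + a * b + b ^+ 2) * A
         - a * (2 * b ^+ 2 + a * b + a ^+ 2) * B) = 0.
    by rewrite -c' EK EH; ring.
  have E : b * (2 * a ^+ 2 + a * b + b ^+ 2) * A
         = a * (2 * b ^+ 2 + a * b + a ^+ 2) * B.
    by apply/eqP; rewrite -subr_eq0; apply/eqP/(mulfI ab'); rewrite Z mulr0.
  have q1 := gt_eqF qa; have q2 := gt_eqF qb.
  exists (A / (a * (2 * b ^+ 2 + a * b + a ^+ 2))).
    by rewrite mulrCA divff ?mulr1 // mulf_neq0 // q2.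
  apply: (mulfI (x := a * (2 * b ^+ 2 + a * b + a ^+ 2))); first by rewrite mulf_neq0 // q2.
  rewrite -E; set Q := a * (_ + a ^+ 2).
  have Q0 : Q != 0 by rewrite mulf_neq0 // q2.
  by rewrite [RHS](mulrCA Q) (mulrCA Q A) divff // mulr1.
rewrite EK1 EH1 in c1; rewrite EK2 EH2 in c2.
have [k1 EA1 EB1] := kappa _ _ c1.
have [k2 EA2 EB2] := kappa _ _ c2.
have D11 : K * (2 * (K * W11)) = K * (3 * H ^+ 2 * H11 + 6 * H * H1 ^+ 2
   - 4 * (H11 * K + 2 * (H1 * K1) + H * K11)) - K11 * (H * (a - b) ^+ 2).
  by rewrite -EW11 -Ew'; ring.
have D22 : K * (2 * (K * W22)) = K * (3 * H ^+ 2 * H22 + 6 * H * H2 ^+ 2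
   - 4 * (H22 * K + 2 * (H2 * K2) + H * K22)) - K22 * (H * (a - b) ^+ 2).
  by rewrite -EW22 -Ew'; ring.
have Dt : K * (2 * (K * Wt)) = K * (3 * H ^+ 2 * Ht - 4 * (Ht * K + H * Kt))
   - Kt * (H * (a - b) ^+ 2).
  by rewrite -EWt -Ew'; ring.
have G1 := gradient_term_le0 a0 b0 hbe.
have G2 := gradient_term_le0 b0 a0 hbe.
set g1 := (X in X <= 0) in G1; set g2 := (X in X <= 0) in G2.
have Key : K * (2 * (K * Wt)) = (2 * a + 2 * be * H) * (K * (2 * (K * W11)))
  + (2 * b + 2 * be * H) * (K * (2 * (K * W22)))
  + g1 * k1 ^+ 2 + g2 * k2 ^+ 2
  - (4 * (a ^+ 3 * b ^+ 3) + 2 * be * (a ^+ 2 * b ^+ 2) * (a + b) ^+ 2) * (a - b) ^+ 2.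
  rewrite D11 D22 Dt EHt EKt Ert Ett EF11 EF22 EH11 EH22 EK11 EK22 EH1 EH2 EK1 EK2 EF.
  by rewrite EA1 EB1 EA2 EB2 EK EH /g1 /g2; ring.
have KK : 0 < K * (2 * K) by rewrite !mulr_gt0.
have E2 : K * (2 * (K * Wt)) = (K * (2 * K)) * Wt by ring.
rewrite -(pmulr_rle0 _ KK) -E2 Key.
have cf1 : 0 <= 2 * a + 2 * be * H by rewrite EH addr_ge0 ?mulr_ge0 ?addr_ge0 // ltW.
have cf2 : 0 <= 2 * b + 2 * be * H by rewrite EH addr_ge0 ?mulr_ge0 ?addr_ge0 // ltW.
have t1 : K * (2 * (K * W11)) <= 0.
  by rewrite pmulr_rle0 // pmulr_rle0 // pmulr_rle0.
have t2 : K * (2 * (K * W22)) <= 0.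
  by rewrite pmulr_rle0 // pmulr_rle0 // pmulr_rle0.
have t3 : 0 <= (4 * (a ^+ 3 * b ^+ 3) + 2 * be * (a ^+ 2 * b ^+ 2) * (a + b) ^+ 2)
   * (a - b) ^+ 2.
  rewrite mulr_ge0 ?sqr_ge0 // addr_ge0 // !mulr_ge0 // ?exprn_ge0 ?addr_ge0 //; exact: ltW.
rewrite subr_le0; apply: le_trans t3.
rewrite -[X in _ <= X](addr0 0) lerD //; last by rewrite mulr_le0_ge0 // sqr_ge0.
rewrite -[X in _ <= X](addr0 0) lerD //; last by rewrite mulr_le0_ge0 // sqr_ge0.
by rewrite -[X in _ <= X](addr0 0) lerD // mulr_ge0_le0.
Qed.
End Real.

(** * Derivations and jets on an open set *)

Section Derivations.
Context {R : realType} {V : normedModType R}.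
Variable O : set V.
Hypothesis oO : open O.
Implicit Types (f g : V -> R) (D : (V -> R) -> V -> R).

(** Functions are only controlled on O, so the ring of smooth functions on O is
represented by total functions, and all identities are required on O only. *)
Record derivation D := Derivation {
  der_smooth : forall f, smooth O f -> smooth O (D f);
  der_add : forall f g x, smooth O f -> smooth O g -> O x ->
    D (f \+ g) x = D f x + D g x;
  der_mul : forall f g x, smooth O f -> smooth O g -> O x ->
    D (f \* g) x = f x * D g x + g x * D f x;
  der_eq : forall f g x, smooth O f -> {in O, f =1 g} -> O x -> D f x = D g x;
  der_cst : forall c x, O x -> D (fun=> c) x = 0 }.

(** The triple (f, D f, D D f) at P behaves like an element of a ring of truncated
power series, so that an identity between functions can be differentiated twice
by structural composition of the lemmas [jet_add], [jet_mul], [jet_cst]. *)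
Record jet D (P : V) f (a b c : R) : Prop := Jet {
  jet_smooth : smooth O f;
  jet0 : f P = a;
  jet1 : D f P = b;
  jet2 : D (D f) P = c }.

Section Jets.
Variables (D : (V -> R) -> V -> R) (dD : derivation D) (P : V) (OP : O P).

Lemma jet_self f : smooth O f -> jet D P f (f P) (D f P) (D (D f) P).
Proof. by move=> sf; split. Qed.

Lemma jet_cst c : jet D P (fun=> c) c 0 0.
Proof.
split=> //; first exact: smooth_cst.
  exact: der_cst.
rewrite (der_eq dD (g := fun=> 0)) //; first exact: der_cst.
  by apply: der_smooth => //; exact: smooth_cst.
by move=> x; rewrite inE => Ox; exact: der_cst.
Qed.

Lemma jet_add f g a b c a' b' c' : jet D P f a b c -> jet D P g a' b' c' ->
  jet D P (f \+ g) (a + a') (b + b') (c + c').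
Proof.
move=> [sf f0 f1 f2] [sg g0 g1 g2].
have sfg := smooth_add oO sf sg.
have sdf := der_smooth dD sf; have sdg := der_smooth dD sg.
split=> //=; rewrite ?f0 ?g0 //.
  by rewrite der_add // f1 g1.
rewrite (der_eq dD (g := D f \+ D g)) //.
- by rewrite der_add // f2 g2.
- exact: der_smooth.
- by move=> x; rewrite inE => Ox; rewrite der_add.
Qed.

Lemma jet_mul f g a b c a' b' c' : jet D P f a b c -> jet D P g a' b' c' ->
  jet D P (f \* g) (a * a') (a * b' + a' * b) (a * c' + 2 * (b * b') + a' * c).
Proof.
move=> [sf f0 f1 f2] [sg g0 g1 g2].
have sfg := smooth_mul oO sf sg.
have sdf := der_smooth dD sf; have sdg := der_smooth dD sg.
split=> //=; rewrite ?f0 ?g0 //.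
  by rewrite der_mul // f0 f1 g0 g1.
rewrite (der_eq dD (g := (f \* D g) \+ (g \* D f))) //.
- rewrite der_add //; [|exact: smooth_mul|exact: smooth_mul].
  by rewrite !der_mul // f0 f1 f2 g0 g1 g2; ring.
- exact: der_smooth.
- by move=> x; rewrite inE => Ox; rewrite der_mul.
Qed.

Lemma jet_eq f g a b c a' b' c' : jet D P f a b c -> jet D P g a' b' c' ->
  (forall x, O x -> f x = g x) -> [/\ a = a', b = b' & c = c'].
Proof.
move=> [sf <- <- <-] [sg <- <- <-] fg.
have fg' : {in O, f =1 g} by move=> x; rewrite inE; exact: fg.
have dfg : {in O, D f =1 D g} by move=> x; rewrite inE => Ox; exact: der_eq.
split; [exact: fg|exact: der_eq|apply: der_eq => //; exact: der_smooth].
Qed.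

End Jets.

Lemma derive_derivation e : derivation (fun f : V -> R => 'D_e f).
Proof.
split.
- by move=> f; exact: smooth_derive.
- move=> f g x sf sg Ox.
  exact: deriveD (smooth_derivable sf Ox) (smooth_derivable sg Ox).
- move=> f g x sf sg Ox.
  exact: deriveM (smooth_derivable sf Ox) (smooth_derivable sg Ox).
- by move=> f g x sf fg Ox; apply: eq_on_derive fg _ _ => //; rewrite inE.
- by move=> c x Ox; exact: derive_cst.
Qed.

Section VectorFields.
Variables d0 d1 d2 : (V -> R) -> V -> R.
Hypotheses (h0 : derivation d0) (h1 : derivation d1) (h2 : derivation d2).
Hypothesis c01 : forall f x, smooth O f -> O x -> d0 (d1 f) x = d1 (d0 f) x.
Hypothesis c02 : forall f x, smooth O f -> O x -> d0 (d2 f) x = d2 (d0 f) x.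
Hypothesis c12 : forall f x, smooth O f -> O x -> d1 (d2 f) x = d2 (d1 f) x.

Definition vfield (c : R) (b1 b2 : V -> R) f : V -> R :=
  fun w => c * d0 f w + (b1 w * d1 f w + b2 w * d2 f w).

Lemma vfield_smooth c b1 b2 f : smooth O b1 -> smooth O b2 -> smooth O f ->
  smooth O (vfield c b1 b2 f).
Proof.
move=> s1 s2 sf.
have S0 := smooth_mul oO (smooth_cst (c : R) oO) (der_smooth h0 sf).
have S1 := smooth_mul oO s1 (der_smooth h1 sf).
have S2 := smooth_mul oO s2 (der_smooth h2 sf).
exact: (smooth_add oO S0 (smooth_add oO S1 S2)).
Qed.

Lemma vfield_derivation c b1 b2 : smooth O b1 -> smooth O b2 ->
  derivation (vfield c b1 b2).
Proof.
move=> s1 s2; split.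
- by move=> f; exact: vfield_smooth.
- move=> f g x sf sg Ox; rewrite /vfield (der_add h0) // (der_add h1) // (der_add h2) //.
  ring.
- move=> f g x sf sg Ox; rewrite /vfield (der_mul h0) // (der_mul h1) // (der_mul h2) //.
  ring.
- move=> f g x sf fg Ox.
  by rewrite /vfield (der_eq h0 sf fg Ox) (der_eq h1 sf fg Ox) (der_eq h2 sf fg Ox).
- by move=> k x Ox; rewrite /vfield (der_cst h0) // (der_cst h1) // (der_cst h2) //; ring.
Qed.

Lemma derivation_vfield d c b1 b2 f x : derivation d ->
  smooth O b1 -> smooth O b2 -> smooth O f -> O x ->
  d (vfield c b1 b2 f) x =
   c * d (d0 f) x + (b1 x * d (d1 f) x + d1 f x * d b1 x
      + (b2 x * d (d2 f) x + d2 f x * d b2 x)).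
Proof.
move=> hd s1 s2 sf Ox.
have t0 := der_smooth h0 sf; have t1 := der_smooth h1 sf; have t2 := der_smooth h2 sf.
have sc : smooth O (fun=> c : R) by exact: smooth_cst.
have S0 := smooth_mul oO sc t0; have S1 := smooth_mul oO s1 t1.
have S2 := smooth_mul oO s2 t2; have S12 := smooth_add oO S1 S2.
have -> : vfield c b1 b2 f = ((fun=> c) \* d0 f) \+ ((b1 \* d1 f) \+ (b2 \* d2 f)).
  by [].
rewrite (der_add hd) // (der_add hd) // !(der_mul hd) // (der_cst hd) //.
by ring.
Qed.

(** The commutator of two vector fields with constant component along d0 is
al d1 + be d2; it vanishes on x and y, hence is zero when dx, dy are
independent. *)
Lemma vfield_comm c b1 b2 c' b1' b2' (x y : V -> R) :
  smooth O b1 -> smooth O b2 -> smooth O b1' -> smooth O b2' ->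
  smooth O x -> smooth O y ->
  (forall w, O w -> d1 x w * d2 y w - d2 x w * d1 y w != 0) ->
  (forall h, h = x \/ h = y ->
    (exists k, forall w, O w -> vfield c b1 b2 h w = k) /\
    (exists k, forall w, O w -> vfield c' b1' b2' h w = k)) ->
  forall f w, smooth O f -> O w ->
    vfield c b1 b2 (vfield c' b1' b2' f) w = vfield c' b1' b2' (vfield c b1 b2 f) w.
Proof.
move=> s1 s2 s1' s2' sx sy J0 Hk f w sf Ow.
have dX := vfield_derivation c s1 s2; have dY := vfield_derivation c' s1' s2'.
pose X := vfield c b1 b2; pose Y := vfield c' b1' b2'.
pose al := X b1' w - Y b1 w; pose be := X b2' w - Y b2 w.
have E h : smooth O h -> X (Y h) w - Y (X h) w = al * d1 h w + be * d2 h w.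
  move=> sh; rewrite /al /be /X /Y [vfield c b1 b2 (_ _ _ _ h) w]/vfield.
  rewrite [vfield c' b1' b2' (_ _ _ _ h) w]/vfield !derivation_vfield //.
  rewrite /vfield (c01 sh Ow) (c02 sh Ow) (c12 sh Ow).
  by ring.
have Z h : h = x \/ h = y -> smooth O h -> al * d1 h w + be * d2 h w = 0.
  move=> hxy sh; rewrite -E //.
  have [[k Hk1] [k' Hk2]] := Hk h hxy; rewrite /X /Y.
  rewrite (der_eq dX (g := fun=> k')) ?(der_cst dX) //; last 2 first.
  - exact: vfield_smooth.
  - by move=> u; rewrite inE => Ou; exact: Hk2.
  rewrite (der_eq dY (g := fun=> k)) ?(der_cst dY) ?subrr //.
  - exact: vfield_smooth.
  - by move=> u; rewrite inE => Ou; exact: Hk1.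
have Zx := Z x (or_introl erefl) sx; have Zy := Z y (or_intror erefl) sy.
have Jw := J0 w Ow.
have al0 : al = 0.
  apply: (mulIf Jw); rewrite mul0r.
  transitivity ((al * d1 x w + be * d2 x w) * d2 y w
     - (al * d1 y w + be * d2 y w) * d2 x w); first by ring.
  by rewrite Zx Zy !mul0r subrr.
have be0 : be = 0.
  apply: (mulIf Jw); rewrite mul0r.
  transitivity ((al * d1 y w + be * d2 y w) * d1 x w
     - (al * d1 x w + be * d2 x w) * d1 y w); first by ring.
  by rewrite Zx Zy !mul0r subrr.
apply/eqP; rewrite -subr_eq0; apply/eqP.
by have := E f sf; rewrite /X /Y => ->; rewrite al0 be0 !mul0r addr0.
Qed.

End VectorFields.

End Derivations.

(** * Evolution of the curvatures of a graph *)

Section Graph.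
Context {R : realType} {V : normedModType R}.
Variable O : set V.
Hypothesis oO : open O.
Variables (P : V) (OP : O P).
Variables (p q r s t v H K F W : V -> R) (be a b : R).
Hypotheses (sp : smooth O p) (sq : smooth O q) (sr : smooth O r) (ss : smooth O s)
  (st : smooth O t) (sv : smooth O v) (sH : smooth O H) (sK : smooth O K)
  (sF : smooth O F) (sW : smooth O W).
Hypothesis Ev : forall x, O x -> v x * v x = 1 + (p x * p x + q x * q x).
Hypothesis EH : forall x, O x -> H x * (v x * (v x * v x)) =
  (1 + q x * q x) * r x + (- 2 * (p x * (q x * s x)) + (1 + p x * p x) * t x).
Hypothesis EK : forall x, O x -> K x * ((v x * v x) * (v x * v x)) =
  r x * t x + - 1 * (s x * s x).
Hypothesis EF : forall x, O x -> F x = (1 + be) * (H x * H x) + - 2 * K x.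
Hypothesis EW : forall x, O x -> 2 * (K x * W x) =
  H x * (H x * H x) + - 4 * (H x * K x).
Hypotheses (pP : p P = 0) (qP : q P = 0) (sP : s P = 0) (rP : r P = a) (tP : t P = b)
  (vP : v P = 1).

Lemma graph_values : [/\ H P = a + b, K P = a * b,
   F P = (1 + be) * (H P) ^+ 2 - 2 * K P &
   2 * (K P * W P) = (H P) ^+ 3 - 4 * (H P * K P)].
Proof.
have := EH OP; have := EK OP; have := EF OP; have := EW OP.
rewrite pP qP sP rP tP vP => -> -> hK hH; split.
- by transitivity (H P * (1 * (1 * 1))); [ring|rewrite hH; ring].
- by transitivity (K P * (1 * 1 * (1 * 1))); [ring|rewrite hK; ring].
- by ring.
- by ring.
Qed.

(** Differentiating the defining identities twice, rather than closed formulas for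
H, K, w, avoids derivatives of quotients and of the square root. *)
Lemma graph_jets D : derivation O D ->
  [/\ D v P = 0 /\ D (D v) P = D p P ^+ 2 + D q P ^+ 2,
      D H P = D r P + D t P /\
      D (D H) P + 3 * H P * D (D v) P =
        D (D r) P + D (D t) P + 2 * D q P ^+ 2 * a + 2 * D p P ^+ 2 * b,
      D K P = D r P * b + a * D t P /\
      D (D K) P + 4 * K P * D (D v) P =
        D (D r) P * b + 2 * (D r P * D t P) + a * D (D t) P - 2 * D s P ^+ 2,
      D (D F) P = (1 + be) * (2 * H P * D (D H) P + 2 * D H P ^+ 2) - 2 * D (D K) P &
      2 * (K P * D W P + D K P * W P) =
        3 * H P ^+ 2 * D H P - 4 * (D H P * K P + H P * D K P) /\
      2 * (K P * D (D W) P + 2 * (D K P * D W P) + D (D K) P * W P) =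
       3 * H P ^+ 2 * D (D H) P + 6 * H P * D H P ^+ 2
        - 4 * (D (D H) P * K P + 2 * (D H P * D K P) + H P * D (D K) P)].
Proof.
move=> dD.
have jp := jet_self D P sp; have jq := jet_self D P sq; have jr := jet_self D P sr.
have js := jet_self D P ss; have jt := jet_self D P st; have jv := jet_self D P sv.
have jH := jet_self D P sH; have jK := jet_self D P sK; have jF := jet_self D P sF.
have jW := jet_self D P sW.
have M := fun f g a b c a' b' c' => @jet_mul _ _ _ oO _ dD P OP f g a b c a' b' c'.
have A := fun f g a b c a' b' c' => @jet_add _ _ _ oO _ dD P OP f g a b c a' b' c'.
have C := fun c => jet_cst oO dD OP c.
have jvv := M _ _ _ _ _ _ _ _ jv jv.
have [_ v1 v2] := jet_eq dD OP jvv
  (A _ _ _ _ _ _ _ _ (C 1) (A _ _ _ _ _ _ _ _ (M _ _ _ _ _ _ _ _ jp jp)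
     (M _ _ _ _ _ _ _ _ jq jq))) Ev.
have [_ H1 H2] := jet_eq dD OP (M _ _ _ _ _ _ _ _ jH (M _ _ _ _ _ _ _ _ jv jvv))
  (A _ _ _ _ _ _ _ _
    (M _ _ _ _ _ _ _ _ (A _ _ _ _ _ _ _ _ (C 1) (M _ _ _ _ _ _ _ _ jq jq)) jr)
    (A _ _ _ _ _ _ _ _
      (M _ _ _ _ _ _ _ _ (C (- 2)) (M _ _ _ _ _ _ _ _ jp (M _ _ _ _ _ _ _ _ jq js)))
      (M _ _ _ _ _ _ _ _ (A _ _ _ _ _ _ _ _ (C 1) (M _ _ _ _ _ _ _ _ jp jp)) jt))) EH.
have [_ K1 K2] := jet_eq dD OP (M _ _ _ _ _ _ _ _ jK (M _ _ _ _ _ _ _ _ jvv jvv))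
  (A _ _ _ _ _ _ _ _ (M _ _ _ _ _ _ _ _ jr jt)
    (M _ _ _ _ _ _ _ _ (C (- 1)) (M _ _ _ _ _ _ _ _ js js))) EK.
have [_ F1 F2] := jet_eq dD OP jF
  (A _ _ _ _ _ _ _ _ (M _ _ _ _ _ _ _ _ (C (1 + be)) (M _ _ _ _ _ _ _ _ jH jH))
     (M _ _ _ _ _ _ _ _ (C (- 2)) jK)) EF.
have [_ W1 W2] := jet_eq dD OP (M _ _ _ _ _ _ _ _ (C 2) (M _ _ _ _ _ _ _ _ jK jW))
  (A _ _ _ _ _ _ _ _ (M _ _ _ _ _ _ _ _ jH (M _ _ _ _ _ _ _ _ jH jH))
     (M _ _ _ _ _ _ _ _ (C (- 4)) (M _ _ _ _ _ _ _ _ jH jK))) EW.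
clear M A C jp jq jr js jt jv jH jK jF jW jvv.
rewrite pP qP sP rP tP vP in v1 v2 H1 H2 K1 K2.
have hv1 : D v P = 0 by lra.
rewrite hv1 in v2 H1 H2 K1 K2.
have hv2 : D (D v) P = D p P ^+ 2 + D q P ^+ 2 by lra.
split.
- by split.
- by split; lra.
- by split; lra.
- by rewrite F2; ring.
- by split; lra.
Qed.

End Graph.

Section GraphFlow.
Context {R : realType} {V : normedModType R}.
Variable O : set V.
Hypothesis oO : open O.
Variables (P : V) (OP : O P).
Variables (D0 D1 D2 : (V -> R) -> V -> R).
Hypotheses (d0 : derivation O D0) (d1 : derivation O D1) (d2 : derivation O D2).
Hypothesis c01 : forall f x, smooth O f -> O x -> D0 (D1 f) x = D1 (D0 f) x.
Hypothesis c02 : forall f x, smooth O f -> O x -> D0 (D2 f) x = D2 (D0 f) x.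
Hypothesis c12 : forall f x, smooth O f -> O x -> D1 (D2 f) x = D2 (D1 f) x.

(** The maximum principle at a point, for a graph moving with D0 z = F v: the
derivatives are collected by [graph_jets] and handed over to
[pinching_jet_le0]. *)
Lemma graph_flow_pinching_le0 (z v H K F W : V -> R) (be : R) :
  let p := D1 z in let q := D2 z in
  let r := D1 p in let s := D2 p in let t := D2 q in
  smooth O z -> smooth O v -> smooth O H -> smooth O K -> smooth O F -> smooth O W ->
  0 <= be <= 5 ->
  (forall x, O x -> v x * v x = 1 + (p x * p x + q x * q x)) ->
  (forall x, O x -> H x * (v x * (v x * v x)) =
    (1 + q x * q x) * r x + (- 2 * (p x * (q x * s x)) + (1 + p x * p x) * t x)) ->
  (forall x, O x -> K x * ((v x * v x) * (v x * v x)) = r x * t x + - 1 * (s x * s x)) ->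
  (forall x, O x -> F x = (1 + be) * (H x * H x) + - 2 * K x) ->
  (forall x, O x -> 2 * (K x * W x) = H x * (H x * H x) + - 4 * (H x * K x)) ->
  (forall x, O x -> D0 z x = F x * v x) ->
  p P = 0 -> q P = 0 -> s P = 0 -> v P = 1 -> 0 < r P -> 0 < t P ->
  D1 W P = 0 -> D2 W P = 0 -> D1 (D1 W) P <= 0 -> D2 (D2 W) P <= 0 ->
  D0 W P <= 0.
Proof.
move=> p q r s t sz sv sH sK sF sW hbe Ev EH EK EF EW Ez pP qP sP vP r0 t0 w1 w2 w11 w22.
have sp : smooth O p := der_smooth d1 sz.
have sq : smooth O q := der_smooth d2 sz.
have sr : smooth O r := der_smooth d1 sp.
have ss : smooth O s := der_smooth d2 sp.
have st : smooth O t := der_smooth d2 sq.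
have Es x : O x -> s x = D1 q x by move=> Ox; rewrite /s /p /q c12.
have J D dD := graph_jets oO OP sp sq sr ss st sv sH sK sF sW Ev EH EK EF EW pP qP sP
   erefl erefl vP (D := D) dD.
have [HP KP FP WP] := graph_values OP EH EK EF EW pP qP sP erefl erefl vP.
have [[v1 v11] [H1 H11] [K1 K11] F11 [W1 W11]] := J _ d1.
have [[v2 v22] [H2 H22] [K2 K22] F22 [W2 W22]] := J _ d2.
have [_ [Ht _] [Kt _] _ [Wt _]] := J _ d0.
have D1q : D1 q P = 0 by rewrite -Es.
have D1p : D1 p P = r P by [].
have D2q : D2 q P = t P by [].
have D2p : D2 p P = 0 by [].
rewrite D1q D1p expr0n /= addr0 in v11.
rewrite D2q D2p expr0n /= add0r in v22.
(* commutation identifies mixed third and fourth derivatives of the height, so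
   that r_2 = s_1, t_1 = s_2 and r_22 = t_11 *)
have in_eq f g : (forall x, O x -> f x = g x) -> {in O, f =1 g :> (V -> R)}.
  by move=> E x; rewrite inE; exact: E.
have D1s x : O x -> D1 s x = D2 r x by move=> Ox; rewrite /s /r c12.
have D2s x : O x -> D2 s x = D1 t x.
  by move=> Ox; rewrite (der_eq d2 (g := D1 q) ss (in_eq _ _ Es) Ox) /t (c12 sq Ox).
have D22r : D2 (D2 r) P = D1 (D1 t) P.
  have -> : D2 (D2 r) P = D2 (D1 s) P.
    apply: (der_eq d2 (der_smooth d2 sr) _ OP).
    by apply: in_eq => x Ox; rewrite D1s.
  rewrite -(c12 ss OP); apply: (der_eq d1 (der_smooth d2 ss) _ OP).
  exact: in_eq.
(* D0 z = F v may be differentiated twice, as D0 commutes with D1 and D2 *)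
have Gj D (dD : derivation O D) := jet_eq dD OP (jet_self D P (der_smooth d0 sz))
  (jet_mul oO dD OP (jet_self D P sF) (jet_self D P sv)) Ez.
have rt : D0 r P = D1 (D1 F) P + F P * (r P) ^+ 2.
  rewrite /r c01 //.
  have E : {in O, D0 p =1 D1 (D0 z)} by apply: in_eq => x Ox; rewrite /p c01.
  rewrite (der_eq d1 (der_smooth d0 sp) E OP).
  have [_ _ ->] := Gj _ d1.
  by rewrite v1 v11 vP /r; ring.
have tt : D0 t P = D2 (D2 F) P + F P * (t P) ^+ 2.
  rewrite /t c02 //.
  have E : {in O, D0 q =1 D2 (D0 z)} by apply: in_eq => x Ox; rewrite /q c02.
  rewrite (der_eq d2 (der_smooth d0 sq) E OP).
  have [_ _ ->] := Gj _ d2.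
  by rewrite v2 v22 vP /t; ring.
apply: (@pinching_jet_le0 R (r P) (t P) be (W P) (D1 r P) (D2 r P) (D1 t P) (D2 t P)
  (D1 (D1 r) P) (D1 (D1 t) P) (D2 (D2 t) P) (D1 (D1 W) P) (D2 (D2 W) P) (D0 W P)
  (H P) (K P) (F P) (D1 H P) (D2 H P) (D1 K P) (D2 K P)
  (D1 (D1 H) P) (D2 (D2 H) P) (D1 (D1 K) P) (D2 (D2 K) P)
  (D1 (D1 F) P) (D2 (D2 F) P) (D0 r P) (D0 t P) (D0 H P) (D0 K P)) => //.
- by rewrite -v11 H11 D1q D1p v11; ring.
- by rewrite -v22 H22 D2q D2p D22r v22; ring.
- by rewrite -v11 K11 D1s.
- by rewrite -v22 K22 D22r D2s.
- by move: W1; rewrite w1 mulr0 add0r.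
- by move: W2; rewrite w2 mulr0 add0r.
- by move: W11; rewrite w1 !mulr0 addr0.
- by move: W22; rewrite w2 !mulr0 addr0.
Qed.

End GraphFlow.

(** * Graph coordinates of a moving surface *)

Section GraphFrame.
Context {R : realType} {V : normedModType R}.
Variables d0 d1 d2 : (V -> R) -> V -> R.
Variables x y : V -> R.

Definition jacobian_det w := d1 x w * d2 y w - d2 x w * d1 y w.

(** By Cramer's rule, [graph_d1] and [graph_d2] are the partial derivatives with
respect to x and y when (x, y) is used as a local coordinate system, and
[graph_d0] is the time derivative at fixed (x, y). *)
Definition graph_d1 := vfield d0 d1 d2 0 (fun w => d2 y w * (jacobian_det w)^-1)
  (fun w => - d1 y w * (jacobian_det w)^-1).
Definition graph_d2 := vfield d0 d1 d2 0 (fun w => - d2 x w * (jacobian_det w)^-1)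
  (fun w => d1 x w * (jacobian_det w)^-1).
Definition graph_d0 := vfield d0 d1 d2 1
  (fun w => - (d0 x w * d2 y w - d0 y w * d2 x w) * (jacobian_det w)^-1)
  (fun w => - (d0 y w * d1 x w - d0 x w * d1 y w) * (jacobian_det w)^-1).

Lemma graph_d1E f w : graph_d1 f w =
  (jacobian_det w)^-1 * (d2 y w * d1 f w - d1 y w * d2 f w).
Proof. by rewrite /graph_d1 /vfield; ring. Qed.

Lemma graph_d2E f w : graph_d2 f w =
  (jacobian_det w)^-1 * (d1 x w * d2 f w - d2 x w * d1 f w).
Proof. by rewrite /graph_d2 /vfield; ring. Qed.

Lemma d1_graph f w : jacobian_det w != 0 ->
  d1 f w = graph_d1 f w * d1 x w + graph_d2 f w * d1 y w.
Proof.
move=> J0; rewrite graph_d1E graph_d2E.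
transitivity ((jacobian_det w)^-1 * jacobian_det w * d1 f w).
  by rewrite mulVf // mul1r.
by rewrite {2}/jacobian_det; ring.
Qed.

Lemma d2_graph f w : jacobian_det w != 0 ->
  d2 f w = graph_d1 f w * d2 x w + graph_d2 f w * d2 y w.
Proof.
move=> J0; rewrite graph_d1E graph_d2E.
transitivity ((jacobian_det w)^-1 * jacobian_det w * d2 f w).
  by rewrite mulVf // mul1r.
by rewrite {2}/jacobian_det; ring.
Qed.

Lemma graph_d0E f w : graph_d0 f w =
  d0 f w - (d0 x w * graph_d1 f w + d0 y w * graph_d2 f w).
Proof. by rewrite graph_d1E graph_d2E /graph_d0 /vfield; ring. Qed.

Lemma graph_d1x w : jacobian_det w != 0 -> graph_d1 x w = 1.
Proof. by move=> J0; rewrite graph_d1E -[RHS](mulVf J0) [in RHS]/jacobian_det; ring. Qed.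
Lemma graph_d1y w : graph_d1 y w = 0.
Proof. by rewrite graph_d1E; ring. Qed.
Lemma graph_d2x w : graph_d2 x w = 0.
Proof. by rewrite graph_d2E; ring. Qed.
Lemma graph_d2y w : jacobian_det w != 0 -> graph_d2 y w = 1.
Proof. by move=> J0; rewrite graph_d2E -[RHS](mulVf J0) [in RHS]/jacobian_det; ring. Qed.
Lemma graph_d0x w : jacobian_det w != 0 -> graph_d0 x w = 0.
Proof. by move=> J0; rewrite graph_d0E graph_d1x // graph_d2x; ring. Qed.
Lemma graph_d0y w : jacobian_det w != 0 -> graph_d0 y w = 0.
Proof. by move=> J0; rewrite graph_d0E graph_d1y graph_d2y //; ring. Qed.

Variable O : set V.
Hypothesis oO : open O.
Hypotheses (h0 : derivation O d0) (h1 : derivation O d1) (h2 : derivation O d2).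
Hypothesis c01 : forall f x, smooth O f -> O x -> d0 (d1 f) x = d1 (d0 f) x.
Hypothesis c02 : forall f x, smooth O f -> O x -> d0 (d2 f) x = d2 (d0 f) x.
Hypothesis c12 : forall f x, smooth O f -> O x -> d1 (d2 f) x = d2 (d1 f) x.
Hypotheses (sx : smooth O x) (sy : smooth O y).
Hypothesis J0 : forall w, O w -> jacobian_det w != 0.

Lemma smooth_sub (f g : V -> R) : smooth O f -> smooth O g -> smooth O (fun w => f w - g w).
Proof. by move=> sf sg; exact: (smooth_add oO sf (smooth_opp oO sg)). Qed.

Lemma smooth_jacobian : smooth O jacobian_det.
Proof.
exact: (smooth_sub (smooth_mul oO (der_smooth h1 sx) (der_smooth h2 sy))
   (smooth_mul oO (der_smooth h2 sx) (der_smooth h1 sy))).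
Qed.

Lemma smooth_jacobianV : smooth O (fun w => (jacobian_det w)^-1).
Proof. exact: (smooth_inv oO J0 smooth_jacobian). Qed.

Let sV := smooth_jacobianV.
Let x0 := der_smooth h0 sx. Let x1 := der_smooth h1 sx. Let x2 := der_smooth h2 sx.
Let y0 := der_smooth h0 sy. Let y1 := der_smooth h1 sy. Let y2 := der_smooth h2 sy.
Let s11 := smooth_mul oO y2 sV.
Let s12 := smooth_mul oO (smooth_opp oO y1) sV.
Let s21 := smooth_mul oO (smooth_opp oO x2) sV.
Let s22 := smooth_mul oO x1 sV.
Let s01 := smooth_mul oO (smooth_opp oO (smooth_sub (smooth_mul oO x0 y2)
   (smooth_mul oO y0 x2))) sV.
Let s02 := smooth_mul oO (smooth_opp oO (smooth_sub (smooth_mul oO y0 x1)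
   (smooth_mul oO x0 y1))) sV.

Lemma graph_d1_coef_smooth :
  smooth O (fun w => d2 y w * (jacobian_det w)^-1) /\
  smooth O (fun w => - d1 y w * (jacobian_det w)^-1).
Proof. by split; [exact: s11 | exact: s12]. Qed.

Lemma graph_d2_coef_smooth :
  smooth O (fun w => - d2 x w * (jacobian_det w)^-1) /\
  smooth O (fun w => d1 x w * (jacobian_det w)^-1).
Proof. by split; [exact: s21 | exact: s22]. Qed.

Lemma graph_d1_derivation : derivation O graph_d1.
Proof. exact: (vfield_derivation oO h0 h1 h2 0 s11 s12). Qed.
Lemma graph_d2_derivation : derivation O graph_d2.
Proof. exact: (vfield_derivation oO h0 h1 h2 0 s21 s22). Qed.
Lemma graph_d0_derivation : derivation O graph_d0.
Proof. exact: (vfield_derivation oO h0 h1 h2 1 s01 s02). Qed.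

Lemma graph_d12 (f : V -> R) w : smooth O f -> O w ->
  graph_d1 (graph_d2 f) w = graph_d2 (graph_d1 f) w.
Proof.
apply: (vfield_comm oO h0 h1 h2 c01 c02 c12 s11 s12 s21 s22 sx sy J0) => h [] ->; split.
- by exists 1 => u Ou; exact: graph_d1x (J0 Ou).
- by exists 0 => u Ou; exact: graph_d2x.
- by exists 0 => u Ou; exact: graph_d1y.
- by exists 1 => u Ou; exact: graph_d2y (J0 Ou).
Qed.

Lemma graph_d01 (f : V -> R) w : smooth O f -> O w ->
  graph_d0 (graph_d1 f) w = graph_d1 (graph_d0 f) w.
Proof.
apply: (vfield_comm oO h0 h1 h2 c01 c02 c12 s01 s02 s11 s12 sx sy J0) => h [] ->; split.
- by exists 0 => u Ou; exact: graph_d0x (J0 Ou).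
- by exists 1 => u Ou; exact: graph_d1x (J0 Ou).
- by exists 0 => u Ou; exact: graph_d0y (J0 Ou).
- by exists 0 => u Ou; exact: graph_d1y.
Qed.

Lemma graph_d02 (f : V -> R) w : smooth O f -> O w ->
  graph_d0 (graph_d2 f) w = graph_d2 (graph_d0 f) w.
Proof.
apply: (vfield_comm oO h0 h1 h2 c01 c02 c12 s01 s02 s21 s22 sx sy J0) => h [] ->; split.
- by exists 0 => u Ou; exact: graph_d0x (J0 Ou).
- by exists 0 => u Ou; exact: graph_d2x.
- by exists 0 => u Ou; exact: graph_d0y (J0 Ou).
- by exists 1 => u Ou; exact: graph_d2y (J0 Ou).
Qed.

End GraphFrame.

Section FundForms.
Context {R : realType}.

(** (al, be, ga) are the components of the unit normal in the frame E1, E2, N; it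
is a multiple of (- p, - q, 1), and the sign eps remains free. *)
Lemma graph_normal (x1 x2 y1 y2 p q v al be ga : R) :
  x1 * y2 - x2 * y1 != 0 -> v * v = 1 + (p * p + q * q) -> 0 < v ->
  al * al + (be * be + ga * ga) = 1 ->
  al * x1 + (be * y1 + ga * (p * x1 + q * y1)) = 0 ->
  al * x2 + (be * y2 + ga * (p * x2 + q * y2)) = 0 ->
  exists eps, [/\ eps * eps = 1, al * v = eps * p, be * v = eps * q & ga * v = - eps].
Proof.
move=> J0 hv v0 hu h1 h2.
have hal : al = - (ga * p).
  apply/eqP; rewrite -subr_eq0; apply/eqP; apply: (mulfI J0); rewrite mulr0.
  transitivity ((al * x1 + (be * y1 + ga * (p * x1 + q * y1))) * y2 -
     (al * x2 + (be * y2 + ga * (p * x2 + q * y2))) * y1); first by ring.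
  by rewrite h1 h2 !mul0r subrr.
have hbe : be = - (ga * q).
  apply/eqP; rewrite -subr_eq0; apply/eqP; apply: (mulfI J0); rewrite mulr0.
  transitivity ((al * x2 + (be * y2 + ga * (p * x2 + q * y2))) * x1 -
     (al * x1 + (be * y1 + ga * (p * x1 + q * y1))) * x2); first by ring.
  by rewrite h1 h2 !mul0r subrr.
exists (- (ga * v)); split; last by rewrite opprK.
- transitivity (ga * ga * (v * v)); first by ring.
  by rewrite hv -[RHS]hu hal hbe; ring.
- by rewrite hal; ring.
- by rewrite hbe; ring.
Qed.

(** Both forms are congruent, through the Jacobian of (x, y), to the matrices
(1 + p^2, p q; p q, 1 + q^2) and eps (r, s; s, t) / v of the graph, so that the
Jacobian drops out of the trace T and the determinant D. *)
Lemma graph_forms (x1 x2 y1 y2 p q r s t v eps g11 g12 g22 h11 h12 h22 H K T D : R) :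
  x1 * y2 - x2 * y1 != 0 -> v * v = 1 + (p * p + q * q) -> 0 < v -> eps * eps = 1 ->
  H * (v * (v * v)) = (1 + q * q) * r + (- 2 * (p * (q * s)) + (1 + p * p) * t) ->
  K * ((v * v) * (v * v)) = r * t + - 1 * (s * s) ->
  g11 = x1 * x1 + (y1 * y1 + (p * x1 + q * y1) * (p * x1 + q * y1)) ->
  g12 = x1 * x2 + (y1 * y2 + (p * x1 + q * y1) * (p * x2 + q * y2)) ->
  g22 = x2 * x2 + (y2 * y2 + (p * x2 + q * y2) * (p * x2 + q * y2)) ->
  h11 * v = eps * (r * (x1 * x1) + (s * (2 * (x1 * y1)) + t * (y1 * y1))) ->
  h12 * v = eps * (r * (x1 * x2) + (s * (x1 * y2 + x2 * y1) + t * (y1 * y2))) ->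
  h22 * v = eps * (r * (x2 * x2) + (s * (2 * (x2 * y2)) + t * (y2 * y2))) ->
  T * (g11 * g22 - g12 * g12) = h11 * g22 + h22 * g11 - 2 * (h12 * g12) ->
  D * (g11 * g22 - g12 * g12) = h11 * h22 - h12 * h12 ->
  T = eps * H /\ D = K.
Proof.
move=> J0 hv v0 he hH hK e11 e12 e22 f11 f12 f22 hT hD.
have vn : v != 0 by rewrite gt_eqF.
have dg : g11 * g22 - g12 * g12 = (x1 * y2 - x2 * y1) ^+ 2 * (v * v).
  by rewrite e11 e12 e22 hv; ring.
have J2 : (x1 * y2 - x2 * y1) ^+ 2 != 0 by rewrite expf_neq0.
have vv : v * v != 0 by rewrite mulf_neq0.
split.
- apply: (mulIf J2); apply: (mulIf vv); apply: (mulIf vn).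
  transitivity (T * (g11 * g22 - g12 * g12) * v); first by rewrite dg; ring.
  rewrite hT.
  transitivity ((h11 * v) * g22 + (h22 * v) * g11 - 2 * ((h12 * v) * g12)); first by ring.
  transitivity (eps * (x1 * y2 - x2 * y1) ^+ 2 * (H * (v * (v * v)))); last by ring.
  by rewrite f11 f12 f22 hH e11 e12 e22; ring.
- apply: (mulIf J2); apply: (mulIf vv); apply: (mulIf vv).
  transitivity (D * (g11 * g22 - g12 * g12) * (v * v)); first by rewrite dg; ring.
  rewrite hD.
  transitivity ((h11 * v) * (h22 * v) - (h12 * v) * (h12 * v)); first by ring.
  transitivity (eps * eps * (x1 * y2 - x2 * y1) ^+ 2 * (K * ((v * v) * (v * v)))); last first.
    by rewrite he; ring.
  by rewrite f11 f12 f22 hK; ring.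
Qed.

End FundForms.

(** * Euclidean linear algebra *)

Section Linear.
Context {R : realType}.

Lemma big_ord2 (F : 'I_2 -> R) : \sum_(i < 2) F i = F 0 + F 1.
Proof. by rewrite !big_ord_recl big_ord0 addr0; congr (_ + F _); apply: val_inj. Qed.

Lemma det_mx2 (A : 'M[R]_2) : \det A = A 0 0 * A 1 1 - A 0 1 * A 1 0.
Proof.
rewrite (expand_det_row _ 0) big_ord2 /cofactor !det_mx11 !mxE /=.
rewrite expr0 expr1 mul1r mulN1r mulrN.
by congr (A _ _ * A _ _ - A _ _ * A _ _); apply: val_inj.
Qed.

(** Multiplying by det g avoids the explicit inverse of g. *)
Lemma char_poly_quotient (h g : 'M[R]_2) (l1 l2 : R) : \det g != 0 ->
  char_poly (h *m invmx g) = ('X - l1%:P) * ('X - l2%:P) ->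
  (l1 + l2) * \det g = h 0 0 * g 1 1 + h 1 1 * g 0 0 - (h 0 1 * g 1 0 + h 1 0 * g 0 1) /\
  l1 * l2 * \det g = \det h.
Proof.
move=> dg; set S := h *m invmx g => E.
have ug : g \in unitmx by rewrite unitmxE unitfE.
have hS : h = S *m g by rewrite /S mulmxKV.
have t : \tr S = l1 + l2.
  have := @char_poly_trace R 2 S isT; rewrite E /= => H.
  by rewrite -[LHS]opprK -H mulrBl !(coefB, coefXM, coefCM, coefX, coefC) /=; ring.
have d : \det S = l1 * l2.
  have := @char_poly_det R 2 S; rewrite E /= expr2 mulrNN mulr1 mul1r => <-.
  by rewrite -!horner_coef0 !hornerE /=; ring.
clearbody S; split; last by rewrite hS det_mulmx d.
rewrite -t /mxtrace big_ord2 det_mx2 hS !mxE !big_ord2.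
by ring.
Qed.

Lemma dotE (u v : 'rV[R]_3) :
  dot u v = u 0 0 * v 0 0 + (u 0 1 * v 0 1 + u 0 2%R * v 0 2%R).
Proof.
rewrite /dot !big_ord_recl big_ord0 addr0.
by congr (u _ _ * v _ _ + (u _ _ * v _ _ + u _ _ * v _ _)); apply: val_inj.
Qed.

Lemma dotC (u v : 'rV[R]_3) : dot u v = dot v u.
Proof. by rewrite /dot; apply: eq_bigr => i _; rewrite mulrC. Qed.

Lemma dotDl (u v w : 'rV[R]_3) : dot (u + v) w = dot u w + dot v w.
Proof. by rewrite !dotE !mxE; ring. Qed.

Lemma dotZl (a : R) (v w : 'rV[R]_3) : dot (a *: v) w = a * dot v w.
Proof. by rewrite !dotE !mxE; ring. Qed.

Lemma dotDr (u v w : 'rV[R]_3) : dot w (u + v) = dot w u + dot w v.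
Proof. by rewrite !dotE !mxE; ring. Qed.

Lemma dotZr (a : R) (v w : 'rV[R]_3) : dot w (a *: v) = a * dot w v.
Proof. by rewrite !dotE !mxE; ring. Qed.

Lemma dotNr (v w : 'rV[R]_3) : dot w (- v) = - dot w v.
Proof. by rewrite -scaleN1r dotZr mulN1r. Qed.

Lemma dotvv_ge0 (u : 'rV[R]_3) : 0 <= dot u u.
Proof. by rewrite dotE -!expr2 !addr_ge0 ?sqr_ge0. Qed.

Lemma dotvv_eq0 (u : 'rV[R]_3) : dot u u = 0 -> u = 0.
Proof.
move/eqP; rewrite /dot psumr_eq0; last by move=> i _; rewrite -expr2 sqr_ge0.
move=> /allP H; apply/rowP => i; have := H i; rewrite mem_index_enum => /(_ isT) /=.
by rewrite mulf_eq0 orbb mxE => /eqP.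
Qed.

Definition orthonormal3 (E1 E2 N : 'rV[R]_3) :=
  [/\ dot E1 E1 = 1, dot E2 E2 = 1 & dot N N = 1] /\
  [/\ dot E1 E2 = 0, dot E1 N = 0 & dot E2 N = 0].

Lemma dot_orthonormal E1 E2 N (u v : 'rV[R]_3) : orthonormal3 E1 E2 N ->
  dot u v = dot u E1 * dot v E1 + (dot u E2 * dot v E2 + dot u N * dot v N).
Proof.
move=> [[e11 e22 nn] [e12 e1n e2n]].
pose Q : 'M[R]_3 := \matrix_(i < 3) (if i == 0 then E1 else if i == 1 then E2 else N).
have dotQ (w w' : 'rV[R]_3) : w *m w'^T = (dot w w')%:M.
  apply/rowP => i; rewrite ord1 !mxE eqxx mulr1n /dot.
  by apply: eq_bigr => j _; rewrite mxE.
have QQ : Q *m Q^T = 1%:M.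
  apply/matrixP => i j; rewrite !mxE.
  transitivity (dot (row i Q) (row j Q)).
    by rewrite /dot; apply: eq_bigr => k _; rewrite !mxE.
  rewrite !rowK; case: i => [[|[|[|//]]] hi]; case: j => [[|[|[|//]]] hj] //=;
  by rewrite // dotC.
have QQ' : Q^T *m Q = 1%:M by exact: mulmx1C.
have rowQ (w : 'rV[R]_3) i : (w *m Q^T) 0 i = dot w (row i Q).
  by rewrite !mxE /dot; apply: eq_bigr => k _; rewrite !mxE.
transitivity (dot (u *m Q^T) (v *m Q^T)); last by rewrite dotE !rowQ !rowK.
have : ((dot u v)%:M : 'M[R]_1) = (dot (u *m Q^T) (v *m Q^T))%:M.
  by rewrite -!dotQ trmx_mul trmxK mulmxA -(mulmxA u) QQ' mulmx1.
by move/matrixP/(_ 0 0); rewrite !mxE eqxx !mulr1n.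
Qed.

Lemma diagonalising_rotation (r s t : R) : exists al be : R,
  al * al + be * be = 1 /\ al * be * (t - r) + (al * al - be * be) * s = 0.
Proof.
have [s0|s0] := eqVneq s 0.
  by exists 1, 0; rewrite s0; split; ring.
pose d := Num.sqrt ((t - r) ^+ 2 + 4 * s ^+ 2).
have D0 : 0 <= (t - r) ^+ 2 + 4 * s ^+ 2 by rewrite addr_ge0 ?sqr_ge0 // mulr_ge0 ?sqr_ge0.
have dd : d * d = (t - r) ^+ 2 + 4 * s ^+ 2 by rewrite -expr2 sqr_sqrtr.
(* (2 s, t - r + d) is an eigenvector of (r, s; s, t) *)
pose m := t - r + d.
pose n2 := (2 * s) ^+ 2 + m ^+ 2.
have n20 : 0 < n2.
  rewrite /n2 ltr_pwDl ?sqr_ge0 // lt_neqAle sqr_ge0 andbT eq_sym sqrf_eq0.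
  by rewrite mulf_eq0 pnatr_eq0.
pose n := Num.sqrt n2.
have nn : n * n = n2 by rewrite -expr2 sqr_sqrtr // ltW.
have n0 : n != 0 by rewrite gt_eqF // sqrtr_gt0.
exists (2 * s / n), (m / n); split.
  transitivity (n2 / (n * n)); first by rewrite /n2; field.
  by rewrite nn divff // gt_eqF.
transitivity (s * (2 * m * (t - r) + 4 * s ^+ 2 - m * m) / (n * n)); first by field.
have -> : 2 * m * (t - r) + 4 * s ^+ 2 - m * m = (t - r) ^+ 2 + 4 * s ^+ 2 - d * d.
  by rewrite /m; ring.
by rewrite dd subrr mulr0 mul0r.
Qed.

(** The first frame is obtained by the Gram-Schmidt process and then rotated to
principal directions: the last equation says that the mixed second derivative s
of the graph vanishes, up to the factor - (x1 y2 - x2 y1)^2. *)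
Lemma principal_frame (Z1 Z2 n : 'rV[R]_3) (h11 h12 h22 : R) :
  dot n n = 1 -> dot Z1 n = 0 -> dot Z2 n = 0 ->
  (forall a b : R, a *: Z1 + b *: Z2 = 0 -> a = 0 /\ b = 0) ->
  exists E1 E2, orthonormal3 E1 E2 (- n) /\
   forall x1 x2 y1 y2, dot Z1 E1 = x1 -> dot Z2 E1 = x2 -> dot Z1 E2 = y1 -> dot Z2 E2 = y2 ->
    x1 * y2 - x2 * y1 != 0 /\
    h11 * (x2 * y2) - h12 * (x1 * y2 + x2 * y1) + h22 * (x1 * y1) = 0.
Proof.
move=> nn n1 n2 free.
have normalize (u : 'rV[R]_3) : u != 0 -> exists2 k, 0 < k & dot (k *: u) (k *: u) = 1.
  move=> u0; have d0 : 0 < dot u u.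
    rewrite lt_neqAle dotvv_ge0 andbT eq_sym; apply: contra u0 => /eqP /dotvv_eq0 ->.
    by rewrite eqxx.
  exists (Num.sqrt (dot u u))^-1; first by rewrite invr_gt0 sqrtr_gt0.
  rewrite dotZl dotZr mulrA -invfM -expr2 sqr_sqrtr ?ltW // mulVf // gt_eqF //.
have Z10 : Z1 != 0.
  apply/eqP => Z0; have [|/eqP h _] := free 1 0; last by move: h; rewrite oner_eq0.
  by rewrite Z0 scaler0 scale0r addr0.
have [k k0 u1] := normalize _ Z10.
pose F1 := k *: Z1.
pose Y := Z2 - dot Z2 F1 *: F1.
have Y0 : Y != 0.
  apply/eqP => Y0; have [|_ /eqP h] := free (- (dot Z2 F1 * k)) 1; last first.
    by move: h; rewrite oner_eq0.
  by rewrite -Y0 /Y /F1 scale1r scalerA addrC scaleNr.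
have [k' k'0 u2] := normalize _ Y0.
pose F2 := k' *: Y.
have f11 : dot F1 F1 = 1 by [].
have f22 : dot F2 F2 = 1 by [].
have f12 : dot F1 F2 = 0.
  rewrite /F2 /Y dotZr dotDr -scaleNr dotZr f11 (dotC F1); ring.
have f1n : dot F1 n = 0 by rewrite /F1 dotZl n1 mulr0.
have f2n : dot F2 n = 0.
  by rewrite /F2 /Y dotZl dotDl -scaleNr dotZl f1n n2 mulr0 addr0 mulr0.
have x1 : dot Z1 F1 != 0.
  apply/eqP => z; have : dot F1 F1 = 0 by rewrite {1}/F1 dotZl z mulr0.
  by rewrite f11 => /eqP; rewrite oner_eq0.
have y1 : dot Z1 F2 = 0.
  apply: (mulfI (x := k)); first by rewrite gt_eqF.
  by rewrite -dotZl -/F1 f12 mulr0.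
have y2 : dot Z2 F2 != 0.
  apply/eqP => z; have : dot F2 F2 = 0.
    rewrite {1}/F2 /Y dotZl dotDl -scaleNr dotZl z f12; ring.
  by rewrite f22 => /eqP; rewrite oner_eq0.
clearbody F2; clear u2 Y0; clearbody Y; clearbody F1.
have [al [be [ab1 ab2]]] := diagonalising_rotation
  (h11 * (dot Z2 F2 * dot Z2 F2))
  (- (h11 * (dot Z2 F1 * dot Z2 F2)
     - h12 * (dot Z1 F1 * dot Z2 F2)))
  (h11 * (dot Z2 F1 * dot Z2 F1)
     - 2 * (h12 * (dot Z1 F1 * dot Z2 F1)) + h22 * (dot Z1 F1 * dot Z1 F1)).
exists (al *: F1 + be *: F2), (- be *: F1 + al *: F2); split; last first.
  move=> _ _ _ _ <- <- <- <-; split.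
  - rewrite !dotDr !dotZr y1.
    have -> : (al * dot Z1 F1 + be * 0) * (- be * dot Z2 F1 + al * dot Z2 F2) -
      (al * dot Z2 F1 + be * dot Z2 F2) * (- be * dot Z1 F1 + al * 0) =
      (al * al + be * be) * (dot Z1 F1 * dot Z2 F2) by ring.
    by rewrite ab1 mul1r mulf_neq0.
  - by rewrite !dotDr !dotZr y1; apply: oppr_inj; rewrite oppr0 -[RHS]ab2; ring.
have D (a b c d : R) : dot (a *: F1 + b *: F2) (c *: F1 + d *: F2) = a * c + b * d.
  by rewrite dotDl !dotDr !dotZl !dotZr f11 f22 (dotC F2) f12; ring.
have Dn (a b : R) : dot (a *: F1 + b *: F2) (- n) = 0.
  by rewrite -scaleN1r dotZr dotDl !dotZl f1n f2n; ring.
split; split; rewrite ?D ?Dn //.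
+ by rewrite -ab1; ring.
+ by rewrite -scaleN1r dotZl dotZr nn; ring.
+ by ring.
Qed.

End Linear.

(** * Spatial derivatives of functions of space and time *)

Section Slices.
Context {R : realType}.
Local Notation V := ('rV[R]_2 * R)%type.

Lemma slice_quotient (W : normedModType R) (f : V -> W) u (tau : R) v :
  (fun h : R => h^-1 *: (((fun u' => f (u', tau)) \o shift u) (h *: v) - f (u, tau))) =
  (fun h : R => h^-1 *: ((f \o shift (u, tau)) (h *: ((v, 0) : V)) - f (u, tau))).
Proof.
apply/funext => h /=; congr (_ *: (f _ - _)).
congr (_, _); rewrite -[LHS]add0r; congr (_ + _); apply/esym; exact: mulr0.
Qed.

Lemma derive_slice (W : normedModType R) (f : V -> W) u (tau : R) v :
  'D_v (fun u' => f (u', tau)) u = 'D_((v, 0) : V) f (u, tau).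
Proof. by rewrite /derive -slice_quotient. Qed.

Lemma smooth_dot (O : set V) (g : V -> 'rV[R]_3) E : open O -> smooth O g ->
  smooth O (fun w => dot (g w) E).
Proof.
move=> oO sg; apply: smooth_sum => // i.
exact: (smooth_mul oO (smooth_coord i oO sg) (smooth_cst (E 0 i) oO)).
Qed.

Lemma derive_dot (O : set V) (g : V -> 'rV[R]_3) E v w : open O -> smooth O g -> O w ->
  'D_v (fun w => dot (g w) E) w = dot ('D_v g w) E.
Proof.
move=> oO sg Ow.
have s i := smooth_mul oO (smooth_coord i oO sg) (smooth_cst (E 0 i) oO).
have d := derive_derivation oO v.
have -> : (fun w => dot (g w) E) =
  ((fun w => g w 0 0) \* (fun=> E 0 0)) \+ (((fun w => g w 0 1) \* (fun=> E 0 1)) \+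
    ((fun w => g w 0 2%R) \* (fun=> E 0 2%R))).
  by apply/funext => w'; rewrite dotE.
rewrite (der_add d) //; last by apply: smooth_add.
rewrite (der_add d) // !(der_mul d) ?(der_cst d) //; do ?[exact: smooth_coord|exact: smooth_cst].
rewrite dotE (derive_mx (smooth_derivable sg Ow)) !mxE.
by rewrite !mulr0 !add0r mulrC [E 0 1 * _]mulrC [E 0 _ * _]mulrC.
Qed.

End Slices.

(** * Curvatures of an embedded surface as those of a graph *)

Section GraphCurvatures.
Context {R : realType}.

(** Z and ZZ stand for the first and second derivatives of the embedding at one
point; X and Y are the first derivatives of its coordinates x and y.  The
hypotheses on dot (Z i) N and dot (ZZ i j) N are the chain rule for the height
as a function of x and y. *)
Lemma curvatures_of_graph_data (E1 E2 N n : 'rV[R]_3) (Z : 'I_2 -> 'rV[R]_3)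
  (ZZ : 'I_2 -> 'I_2 -> 'rV[R]_3) (X Y : 'I_2 -> R) (p q r s t v H K l1 l2 : R) :
  orthonormal3 E1 E2 N ->
  (forall i, dot (Z i) E1 = X i) -> (forall i, dot (Z i) E2 = Y i) ->
  (forall i, dot (Z i) N = p * X i + q * Y i) ->
  (forall i j, dot (ZZ i j) N = p * dot (ZZ i j) E1 + q * dot (ZZ i j) E2
    + (r * X i + s * Y i) * X j + (s * X i + t * Y i) * Y j) ->
  X 0 * Y 1 - X 1 * Y 0 != 0 ->
  v * v = 1 + (p * p + q * q) -> 0 < v ->
  H * (v * (v * v)) = (1 + q * q) * r + (- 2 * (p * (q * s)) + (1 + p * p) * t) ->
  K * ((v * v) * (v * v)) = r * t + - 1 * (s * s) ->
  dot n n = 1 -> (forall i, dot (Z i) n = 0) ->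
  char_poly ((\matrix_(i, j) - dot (ZZ i j) n) *m
     invmx (\matrix_(i, j) dot (Z i) (Z j) : 'M[R]_2)) = ('X - l1%:P) * ('X - l2%:P) ->
  exists eps, [/\ eps * eps = 1, l1 + l2 = eps * H /\ l1 * l2 = K,
    [/\ dot n E1 * v = eps * p, dot n E2 * v = eps * q & dot n N * v = - eps] &
    forall i j, - dot (ZZ i j) n * v = eps * (r * (X i * X j) +
       (s * (X i * Y j + X j * Y i) + t * (Y i * Y j)))].
Proof.
move=> oE zx zy zz zzn J0 vv v0 hH hK nn n0.
set h := (X in X *m _); set G := (X in _ *m invmx X) => hc.
have n1 i : dot n E1 * X i + (dot n E2 * Y i + dot n N * (p * X i + q * Y i)) = 0.
  by rewrite -zz -[RHS](n0 i) [RHS](dot_orthonormal _ _ oE) zx zy; ring.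
have [eps [he ha hb hg]] : exists eps, [/\ eps * eps = 1, dot n E1 * v = eps * p,
   dot n E2 * v = eps * q & dot n N * v = - eps].
  apply: (graph_normal J0 vv v0); [|exact: n1|exact: n1].
  by rewrite -nn [RHS](dot_orthonormal _ _ oE).
have hh i j : - dot (ZZ i j) n * v = eps * (r * (X i * X j) +
       (s * (X i * Y j + X j * Y i) + t * (Y i * Y j))).
  rewrite (dot_orthonormal _ _ oE).
  transitivity (- (dot (ZZ i j) E1 * (dot n E1 * v) + dot (ZZ i j) E2 * (dot n E2 * v)
    + dot (ZZ i j) N * (dot n N * v))); first by ring.
  by rewrite ha hb hg zzn; ring.
have gE i j : G i j = X i * X j + (Y i * Y j + (p * X i + q * Y i) * (p * X j + q * Y j)).
  by rewrite mxE (dot_orthonormal _ _ oE) !zx !zy !zz.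
have hE i j : h i j = - dot (ZZ i j) n by rewrite mxE.
have dG : \det G = (X 0 * Y 1 - X 1 * Y 0) ^+ 2 * (v * v).
  by rewrite det_mx2 !gE vv; ring.
have dG0 : \det G != 0.
  by rewrite dG mulf_neq0 ?expf_neq0 // mulf_neq0 // gt_eqF.
have [hT hD] := char_poly_quotient dG0 hc.
have hs : h 1 0 = h 0 1.
  have vn : v != 0 by rewrite gt_eqF.
  by apply: (mulIf vn); rewrite !hE !hh; ring.
have Gs : G 1 0 = G 0 1 by rewrite !gE; ring.
exists eps; split=> //.
rewrite hs det_mx2 Gs in hT; rewrite !det_mx2 hs Gs in hD.
apply: (graph_forms (g11 := G 0 0) (g12 := G 0 1) (g22 := G 1 1)
  (h11 := h 0 0) (h12 := h 0 1) (h22 := h 1 1) J0 vv v0 he hH hK) => //.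
- by rewrite hE hh; ring.
- by rewrite hE hh; ring.
- by rewrite hE hh; ring.
- by rewrite hT; ring.
Qed.

End GraphCurvatures.

Section GraphSurface.
Context {R : realType}.
Local Notation V := ('rV[R]_2 * R)%type.

Definition space_dir (i : 'I_2) : V := (delta_mx 0 i, 0).
Definition time_dir : V := (0, 1).

Notation d0 := (fun f : V -> R => 'D_time_dir f).
Notation d1 := (fun f : V -> R => 'D_(space_dir 0) f).
Notation d2 := (fun f : V -> R => 'D_(space_dir 1) f).

Variables (g : V -> 'rV[R]_3) (E1 E2 N : 'rV[R]_3) (be : R).

(** Coordinates of the embedding g in the frame E1, E2, N, and then the first and
second derivatives of the height gz as a function of gx, gy; gv, gH, gK are the
area density, mean curvature and Gauss curvature of the graph, gF the speed of
the flow, gW the pinching quantity.  They are written in the form required by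
[graph_flow_pinching_le0]. *)
Definition gx w := dot (g w) E1.
Definition gy w := dot (g w) E2.
Definition gz w := dot (g w) N.
Definition gJ := jacobian_det d1 d2 gx gy.
Definition gD0 := graph_d0 d0 d1 d2 gx gy.
Definition gD1 := graph_d1 d0 d1 d2 gx gy.
Definition gD2 := graph_d2 d0 d1 d2 gx gy.
Definition gp := gD1 gz.
Definition gq := gD2 gz.
Definition gr := gD1 gp.
Definition gs := gD2 gp.
Definition gt := gD2 gq.
Definition gv w := Num.sqrt (1 + (gp w * gp w + gq w * gq w)).
Definition gH w := ((1 + gq w * gq w) * gr w
   + (- 2 * (gp w * (gq w * gs w)) + (1 + gp w * gp w) * gt w))
   * ((gv w)^-1 * ((gv w)^-1 * (gv w)^-1)).
Definition gK w := (gr w * gt w + - 1 * (gs w * gs w))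
   * (((gv w)^-1 * (gv w)^-1) * ((gv w)^-1 * (gv w)^-1)).
Definition gF w := (1 + be) * (gH w * gH w) + - 2 * gK w.
Definition gW w := (gH w * (gH w * gH w) + - 4 * (gH w * gK w)) * (2 * gK w)^-1.

Lemma slope_ge0 w : 0 <= gp w * gp w + gq w * gq w.
Proof. by rewrite -!expr2 addr_ge0 ?sqr_ge0. Qed.

Lemma gv_gt0 w : 0 < gv w.
Proof. by rewrite /gv sqrtr_gt0 ltr_pwDl // slope_ge0. Qed.

Lemma gv_sqr w : gv w * gv w = 1 + (gp w * gp w + gq w * gq w).
Proof. by rewrite /gv -expr2 sqr_sqrtr // addr_ge0 // slope_ge0. Qed.

Lemma gH_v w : gH w * (gv w * (gv w * gv w)) = (1 + gq w * gq w) * gr w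
   + (- 2 * (gp w * (gq w * gs w)) + (1 + gp w * gp w) * gt w).
Proof.
have v0 : gv w != 0 by rewrite gt_eqF // gv_gt0.
rewrite /gH -mulrA -[RHS]mulr1; congr (_ * _).
by rewrite -!invfM mulVf // !mulf_neq0.
Qed.

Lemma gK_v w : gK w * ((gv w * gv w) * (gv w * gv w)) = gr w * gt w + - 1 * (gs w * gs w).
Proof.
have v0 : gv w != 0 by rewrite gt_eqF // gv_gt0.
rewrite /gK -mulrA -[RHS]mulr1; congr (_ * _).
by rewrite -!invfM mulVf // !mulf_neq0.
Qed.

Lemma gW_K w : gK w != 0 -> 2 * (gK w * gW w) = gH w * (gH w * gH w) + - 4 * (gH w * gK w).
Proof.
move=> K0; rewrite mulrA /gW mulrC -mulrA mulVf ?mulr1 //.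
by rewrite mulf_neq0 // pnatr_eq0.
Qed.

Section OnOpen.
Variable O : set V.
Hypothesis oO : open O.
Hypothesis sg : smooth O g.
Hypothesis J0 : forall w, O w -> gJ w != 0.

Let h0 : derivation O d0 := derive_derivation oO time_dir.
Let h1 : derivation O d1 := derive_derivation oO (space_dir 0).
Let h2 : derivation O d2 := derive_derivation oO (space_dir 1).

Lemma time_d1_comm (f : V -> R) x : smooth O f -> O x -> d0 (d1 f) x = d1 (d0 f) x.
Proof. by move=> sf Ox; exact: (derive_comm _ _ oO sf Ox). Qed.
Lemma time_d2_comm (f : V -> R) x : smooth O f -> O x -> d0 (d2 f) x = d2 (d0 f) x.
Proof. by move=> sf Ox; exact: (derive_comm _ _ oO sf Ox). Qed.
Lemma d1_d2_comm (f : V -> R) x : smooth O f -> O x -> d1 (d2 f) x = d2 (d1 f) x.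
Proof. by move=> sf Ox; exact: (derive_comm _ _ oO sf Ox). Qed.

Let sx : smooth O gx := smooth_dot E1 oO sg.
Let sy : smooth O gy := smooth_dot E2 oO sg.
Let sz : smooth O gz := smooth_dot N oO sg.

Lemma gD0_derivation : derivation O gD0.
Proof. exact: (graph_d0_derivation oO h0 h1 h2 sx sy J0). Qed.
Lemma gD1_derivation : derivation O gD1.
Proof. exact: (graph_d1_derivation oO h0 h1 h2 sx sy J0). Qed.
Lemma gD2_derivation : derivation O gD2.
Proof. exact: (graph_d2_derivation oO h0 h1 h2 sx sy J0). Qed.
Lemma gD12 (f : V -> R) w : smooth O f -> O w -> gD1 (gD2 f) w = gD2 (gD1 f) w.
Proof. exact: (graph_d12 oO h0 h1 h2 time_d1_comm time_d2_comm d1_d2_comm sx sy J0). Qed.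
Lemma gD01 (f : V -> R) w : smooth O f -> O w -> gD0 (gD1 f) w = gD1 (gD0 f) w.
Proof. exact: (graph_d01 oO h0 h1 h2 time_d1_comm time_d2_comm d1_d2_comm sx sy J0). Qed.
Lemma gD02 (f : V -> R) w : smooth O f -> O w -> gD0 (gD2 f) w = gD2 (gD0 f) w.
Proof. exact: (graph_d02 oO h0 h1 h2 time_d1_comm time_d2_comm d1_d2_comm sx sy J0). Qed.

Let sp : smooth O gp := der_smooth gD1_derivation sz.
Let sq : smooth O gq := der_smooth gD2_derivation sz.
Let sr : smooth O gr := der_smooth gD1_derivation sp.
Let ss : smooth O gs := der_smooth gD2_derivation sp.
Let st : smooth O gt := der_smooth gD2_derivation sq.
Let cst (c : R) : smooth O (fun=> c) := smooth_cst c oO.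

Lemma smooth_gv : smooth O gv.
Proof.
apply: smooth_sqrt => //.
  by move=> w _; rewrite ltr_pwDl // slope_ge0.
exact: (smooth_add oO (cst 1) (smooth_add oO (smooth_mul oO sp sp) (smooth_mul oO sq sq))).
Qed.

Let svi : smooth O (fun w => (gv w)^-1).
Proof. by apply: (smooth_inv oO _ smooth_gv) => w _; rewrite gt_eqF // gv_gt0. Qed.

Lemma smooth_gH : smooth O gH.
Proof.
exact: (smooth_mul oO (smooth_add oO
    (smooth_mul oO (smooth_add oO (cst 1) (smooth_mul oO sq sq)) sr)
    (smooth_add oO
      (smooth_mul oO (cst (- 2)) (smooth_mul oO sp (smooth_mul oO sq ss)))
      (smooth_mul oO (smooth_add oO (cst 1) (smooth_mul oO sp sp)) st)))
  (smooth_mul oO svi (smooth_mul oO svi svi))).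
Qed.

Lemma smooth_gK : smooth O gK.
Proof.
have svv := smooth_mul oO svi svi.
exact: (smooth_mul oO (smooth_add oO (smooth_mul oO sr st)
    (smooth_mul oO (cst (- 1)) (smooth_mul oO ss ss))) (smooth_mul oO svv svv)).
Qed.

Lemma smooth_gF : smooth O gF.
Proof.
exact: (smooth_add oO (smooth_mul oO (cst (1 + be)) (smooth_mul oO smooth_gH smooth_gH))
  (smooth_mul oO (cst (- 2)) smooth_gK)).
Qed.

Lemma smooth_gW : (forall w, O w -> gK w != 0) -> smooth O gW.
Proof.
move=> K0; have sH := smooth_gH; have sK := smooth_gK.
have s2K : smooth O (fun w => (2 * gK w)^-1).
  apply: smooth_inv => //; last exact: (smooth_mul oO (cst 2) sK).
  by move=> w Ow; rewrite mulf_neq0 ?pnatr_eq0 // K0.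
exact: (smooth_mul oO (smooth_add oO (smooth_mul oO sH (smooth_mul oO sH sH))
  (smooth_mul oO (cst (- 4)) (smooth_mul oO sH sK))) s2K).
Qed.

Lemma dot_derive (i : 'I_2) E w : O w -> dot ('D_(space_dir i) g w) E =
  'D_(space_dir i) (fun w => dot (g w) E) w.
Proof. by move=> Ow; rewrite (derive_dot _ _ oO sg Ow). Qed.

Lemma dot_derive2 (i j : 'I_2) E w : O w -> dot ('D_(space_dir i) ('D_(space_dir j) g) w) E =
  'D_(space_dir i) ('D_(space_dir j) (fun w => dot (g w) E)) w.
Proof.
move=> Ow; rewrite -(derive_dot _ _ oO (smooth_derive _ sg) Ow).
have fg : {in O, (fun w => dot ('D_(space_dir j) g w) E) =1
    'D_(space_dir j) (fun w => dot (g w) E)}.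
  by move=> u; rewrite inE => Ou; rewrite (derive_dot _ _ oO sg Ou).
by apply: (eq_on_derive _ oO fg); rewrite inE.
Qed.

Lemma g_chain (f : V -> R) (i : 'I_2) w : O w -> 'D_(space_dir i) f w =
  gD1 f w * 'D_(space_dir i) gx w + gD2 f w * 'D_(space_dir i) gy w.
Proof.
move=> Ow; have /= H1 := d1_graph d0 f (J0 Ow); have /= H2 := d2_graph d0 f (J0 Ow).
have [->|->] : i = 0 \/ i = 1.
  by case: i => [[|[|//]]] hi; [left|right]; apply: val_inj.
- exact: H1.
- exact: H2.
Qed.

Lemma gz_derive2 (i j : 'I_2) w : O w -> 'D_(space_dir i) ('D_(space_dir j) gz) w =
  gp w * 'D_(space_dir i) ('D_(space_dir j) gx) w
  + gq w * 'D_(space_dir i) ('D_(space_dir j) gy) w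
  + (gr w * 'D_(space_dir i) gx w + gs w * 'D_(space_dir i) gy w) * 'D_(space_dir j) gx w
  + (gs w * 'D_(space_dir i) gx w + gt w * 'D_(space_dir i) gy w) * 'D_(space_dir j) gy w.
Proof.
move=> Ow; have hd := derive_derivation oO (space_dir i).
have E : {in O, 'D_(space_dir j) gz =1
   (gp \* 'D_(space_dir j) gx) \+ (gq \* 'D_(space_dir j) gy)}.
  by move=> u; rewrite inE => Ou; rewrite g_chain.
have sxj := smooth_derive (space_dir j) sx; have syj := smooth_derive (space_dir j) sy.
rewrite (der_eq hd (smooth_derive (space_dir j) sz) E Ow).
rewrite (der_add hd) //; [|exact: smooth_mul|exact: smooth_mul].
rewrite !(der_mul hd) // (g_chain gp i Ow) (g_chain gq i Ow).
rewrite (_ : gD1 gq w = gs w); last by rewrite /gq gD12.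
rewrite -[gD1 gp w]/(gr w) -[gD2 gp w]/(gs w) -[gD2 gq w]/(gt w).
move: (gp w) (gq w) (gr w) (gs w) (gt w) ('D_(space_dir i) gx w) ('D_(space_dir i) gy w)
  ('D_(space_dir j) gx w) ('D_(space_dir j) gy w)
  ('D_(space_dir i) ('D_(space_dir j) gx) w) ('D_(space_dir i) ('D_(space_dir j) gy) w).
by move=> *; ring.
Qed.

(** The sign eps tells whether n is the downward normal of the graph, that is, the
one with a negative component along N. *)
Lemma graph_curvatures w n (l1 l2 : R) : O w -> orthonormal3 E1 E2 N ->
  dot n n = 1 -> (forall i, dot ('D_(space_dir i) g w) n = 0) ->
  char_poly ((\matrix_(i, j) - dot ('D_(space_dir i) ('D_(space_dir j) g) w) n) *m
     invmx (\matrix_(i, j) dot ('D_(space_dir i) g w) ('D_(space_dir j) g w) : 'M[R]_2)) =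
    ('X - l1%:P) * ('X - l2%:P) ->
  exists eps, [/\ eps * eps = 1, l1 + l2 = eps * gH w /\ l1 * l2 = gK w,
    [/\ dot n E1 * gv w = eps * gp w, dot n E2 * gv w = eps * gq w &
        dot n N * gv w = - eps] &
    forall i j, - dot ('D_(space_dir i) ('D_(space_dir j) g) w) n * gv w = eps *
      (gr w * ('D_(space_dir i) gx w * 'D_(space_dir j) gx w) +
       (gs w * ('D_(space_dir i) gx w * 'D_(space_dir j) gy w
               + 'D_(space_dir j) gx w * 'D_(space_dir i) gy w)
        + gt w * ('D_(space_dir i) gy w * 'D_(space_dir j) gy w)))].
Proof.
move=> Ow oE nn n0 hc.
apply: (@curvatures_of_graph_data R E1 E2 N n (fun i => 'D_(space_dir i) g w)
  (fun i j => 'D_(space_dir i) ('D_(space_dir j) g) w)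
  (fun i => 'D_(space_dir i) gx w) (fun i => 'D_(space_dir i) gy w)
  (gp w) (gq w) (gr w) (gs w) (gt w) (gv w) (gH w) (gK w) l1 l2
  oE (fun i => dot_derive i E1 Ow) (fun i => dot_derive i E2 Ow)
  (fun i => etrans (dot_derive i N Ow) (g_chain gz i Ow)) _ (J0 Ow)
  (gv_sqr w) (gv_gt0 w) (gH_v w) (gK_v w) nn n0 hc) => i j.
exact: (etrans (dot_derive2 i j N Ow) (etrans (gz_derive2 i j Ow)
  (congr2 (fun a b => gp w * a + gq w * b + _ + _)
    (esym (dot_derive2 i j E1 Ow)) (esym (dot_derive2 i j E2 Ow))))).
Qed.

End OnOpen.

End GraphSurface.

(** * Second derivatives at a critical point *)

Section SecondOrder.
Context {R : realType} {V : normedModType R}.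
Variable O : set V.
Hypothesis oO : open O.

Lemma derivation_critical (d0 d1 d2 dx : (V -> R) -> V -> R)
    (b1 b2 : V -> R) (f : V -> R) P :
  derivation O d0 -> derivation O d1 -> derivation O d2 -> derivation O dx ->
  (forall h w, smooth O h -> O w -> d1 (d2 h) w = d2 (d1 h) w) ->
  (forall h w, smooth O h -> O w -> dx h w = b1 P * d1 h w + b2 P * d2 h w) ->
  smooth O b1 -> smooth O b2 -> smooth O f -> O P -> d1 f P = 0 -> d2 f P = 0 ->
  vfield d0 d1 d2 0 b1 b2 (vfield d0 d1 d2 0 b1 b2 f) P = dx (dx f) P.
Proof.
move=> h0 h1 h2 hx c12 Dx s1 s2 sf OP f1 f2.
have E : {in O, dx f =1 ((fun=> b1 P) \* d1 f) \+ ((fun=> b2 P) \* d2 f)}.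
  by move=> w; rewrite inE => Ow; rewrite Dx.
have sd1 := der_smooth h1 sf; have sd2 := der_smooth h2 sf.
have sc1 : smooth O (fun=> b1 P) := smooth_cst (b1 P) oO.
have sc2 : smooth O (fun=> b2 P) := smooth_cst (b2 P) oO.
have R1 : dx (dx f) P = b1 P * dx (d1 f) P + b2 P * dx (d2 f) P.
  have m1 := smooth_mul oO sc1 sd1; have m2 := smooth_mul oO sc2 sd2.
  rewrite (der_eq hx (der_smooth hx sf) E OP) (der_add hx m1 m2 OP).
  rewrite (der_mul hx sc1 sd1 OP) (der_mul hx sc2 sd2 OP).
  by rewrite !(der_cst hx _ OP) !mulr0 !addr0.
rewrite R1 [LHS]/vfield mul0r add0r (Dx _ _ sd1 OP) (Dx _ _ sd2 OP).
rewrite (derivation_vfield oO h0 h1 h2 0 h1 s1 s2 sf OP).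
rewrite (derivation_vfield oO h0 h1 h2 0 h2 s1 s2 sf OP).
by rewrite f1 f2 (c12 f P sf OP); ring.
Qed.

(** At a critical point of f the derivatives of the coefficients b1, b2 do not
contribute, so that X X f is a value of the Hessian of f; this transfers the
second derivative test from chart coordinates to graph coordinates. *)
Lemma vfield_critical (e0 e1 e2 : V) (b1 b2 : V -> R) (f : V -> R) P :
  smooth O b1 -> smooth O b2 ->
  smooth O f -> O P -> 'D_e1 f P = 0 -> 'D_e2 f P = 0 ->
  let X := vfield (fun f : V -> R => 'D_e0 f) (fun f : V -> R => 'D_e1 f)
     (fun f : V -> R => 'D_e2 f) 0 b1 b2 in
  let xi := b1 P *: e1 + b2 P *: e2 in
  X (X f) P = 'D_xi ('D_xi f) P.
Proof.
move=> s1 s2 sf OP f1 f2 X xi.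
apply: (derivation_critical (derive_derivation oO e0) (derive_derivation oO e1)
  (derive_derivation oO e2) (derive_derivation oO xi) _ _ s1 s2 sf OP f1 f2).
- by move=> h w sh Ow; exact: (derive_comm _ _ oO sh Ow).
- move=> h w sh Ow; apply: etrans (derive_addv _ _ oO sh Ow) _.
  by apply: (congr2 +%R); exact: (derive_scalev _ _ oO sh Ow).
Qed.

End SecondOrder.

(** * The pinching quantity near a point of space-time *)

Section Preliminaries.
Context {R : realType}.

Lemma open_smooth_preimage (V : normedModType R) (O : set V) (f : V -> R) (D : set R) :
  open O -> smooth O f -> open D -> open (O `&` [set w | D (f w)]).
Proof.
move=> oO sf oD; rewrite openE => w [Ow Dw]; rewrite /interior.
have N1 : nbhs w O by apply: open_nbhs_nbhs; split.
have N2 : nbhs w [set w | D (f w)].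
  have cf : {for w, continuous f} := smooth_continuous sf Ow.
  by apply: (cf D); apply: open_nbhs_nbhs; split.
exact: filterI N1 N2.
Qed.

Lemma sign_eq1 (e : R) : e * e = 1 -> 0 < e -> e = 1.
Proof.
move=> e1 e0; apply/eqP; rewrite -subr_eq0.
have : (e - 1) * (e + 1) = 0 by transitivity (e * e - 1); [ring|rewrite e1 subrr].
by move/eqP; rewrite mulf_eq0 => /orP[//|]; rewrite gt_eqF // addr_gt0.
Qed.

(** At the base point the normal is - N, so p = q = 0, v = 1 and eps = 1; the
principal axes give s = 0.  Then r and t have sum H > 0 and product K > 0. *)
Lemma graph_base_point (x1 x2 y1 y2 p q r s t v H K eps l1 l2 nN h11 h12 h22 : R) :
  x1 * y2 - x2 * y1 != 0 -> 0 < v ->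
  H * (v * (v * v)) = (1 + q * q) * r + (- 2 * (p * (q * s)) + (1 + p * p) * t) ->
  K * ((v * v) * (v * v)) = r * t + - 1 * (s * s) ->
  eps * eps = 1 -> l1 + l2 = eps * H -> l1 * l2 = K -> 0 < l1 -> 0 < l2 ->
  0 * v = eps * p -> 0 * v = eps * q -> nN * v = - eps -> nN = - 1 ->
  h11 * v = eps * (r * (x1 * x1) + (s * (x1 * y1 + x1 * y1) + t * (y1 * y1))) ->
  h12 * v = eps * (r * (x1 * x2) + (s * (x1 * y2 + x2 * y1) + t * (y1 * y2))) ->
  h22 * v = eps * (r * (x2 * x2) + (s * (x2 * y2 + x2 * y2) + t * (y2 * y2))) ->
  h11 * (x2 * y2) - h12 * (x1 * y2 + x2 * y1) + h22 * (x1 * y1) = 0 ->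
  [/\ p = 0, q = 0 & s = 0] /\ [/\ v = 1, 0 < r, 0 < t, 0 < H & 0 < K].
Proof.
move=> J0 v0 hH hK he hl hm l10 l20 hp hq hn nN1 f11 f12 f22 hs.
have ev : eps = v by rewrite -[LHS]opprK -hn nN1 mulN1r opprK.
have e1 : eps = 1 by apply: sign_eq1 => //; rewrite ev.
have v1 : v = 1 by rewrite -ev.
rewrite e1 !mul1r ?mul0r in hp hq hl.
have p0 : p = 0 by rewrite -hp.
have q0 : q = 0 by rewrite -hq.
rewrite p0 q0 v1 in hH.
rewrite v1 e1 !mulr1 !mul1r in f11 f12 f22.
have s0 : s = 0.
  apply: (mulIf (expf_neq0 2 J0)); rewrite mul0r -[RHS]oppr0 -[in RHS]hs.
  by rewrite f11 f12 f22; ring.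
rewrite v1 s0 in hK hH.
have hH' : r + t = H by rewrite -[H]mulr1 -[1]mulr1 -[X in _ * (1 * X)]mulr1 hH; ring.
have hK' : r * t = K.
  transitivity (K * (1 * 1 * (1 * 1))); last by ring.
  by rewrite hK; ring.
have H0 : 0 < H by rewrite -hl addr_gt0.
have K0 : 0 < K by rewrite -hm mulr_gt0.
have r0 : 0 < r.
  rewrite ltNge; apply/negP => r0.
  have t0 : 0 < t by rewrite -(subrK r t) [t - r + r]addrC; lra.
  by have := mulr_le0_ge0 r0 (ltW t0); rewrite hK' leNgt K0.
have t0 : 0 < t by rewrite -(pmulr_rgt0 _ r0) hK'.
by split; split.
Qed.

Lemma mulr_sub_mulr0 (a b c : R) : a * (b * 0 - c * 0) = 0.
Proof. by rewrite !mulr0 subr0 mulr0. Qed.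

Lemma pinching_HK (l1 l2 : R) : 0 < l1 -> 0 < l2 ->
  (l1 + l2) * (l1 - l2) ^+ 2 / (2 * l1 * l2) =
  ((l1 + l2) * ((l1 + l2) * (l1 + l2)) + - 4 * ((l1 + l2) * (l1 * l2))) *
    (2 * (l1 * l2))^-1.
Proof.
move=> h1 h2; rewrite mulrA; congr (_ / _); ring.
Qed.

End Preliminaries.

Section Local.
Context {R : realType}.
Variables (beta : R) (T : \bar R)
    (M : topologicalType) (A : set (chart R M)) (X : M -> R -> 'rV[R]_3)
    (nu : M -> R -> 'rV[R]_3) (lam1 lam2 : M -> R -> R).
Hypotheses (hbeta : 0 <= beta <= 5)
    (hM : closed_surface A)
    (hX : smooth_family A (times T) X)
    (hemb : forall t, times T t -> embedding A (X ^~ t))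
    (hnu : forall t x, times T t -> outer_unit_normal A (X ^~ t) x (nu x t))
    (hlam : forall t x, times T t ->
       principal_curvatures A (X ^~ t) x (nu x t) (lam1 x t) (lam2 x t))
    (hconvex : forall t x, times T t -> 0 < lam1 x t /\ 0 < lam2 x t)
    (hflow : forall t x, times T t ->
       has_velocity (times T) (X x) t
         (- (((lam1 x t) ^+ 2 + (lam2 x t) ^+ 2)
              + beta * (lam1 x t + lam2 x t) ^+ 2) *: nu x t)).
Local Notation V := ('rV[R]_2 * R)%type.
Local Notation I := (times T).

Definition pinching x t := (lam1 x t + lam2 x t) * (lam1 x t - lam2 x t) ^+ 2
           / (2 * lam1 x t * lam2 x t).

Lemma nbhs_slice (u : 'rV[R]_2) (tau : R) (S : set V) :
  nbhs ((u, tau) : V) S -> nbhs u [set u' | S (u', tau)].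
Proof.
move=> [[Q1 Q2] [/= q1 q2] sub]; apply: filterS q1 => u' Qu'.
by apply: sub; split => //=; exact: nbhs_singleton q2.
Qed.

Lemma nbhs_slice_time (u : 'rV[R]_2) (tau : R) (S : set V) :
  nbhs ((u, tau) : V) S -> nbhs tau [set s | S (u, s)].
Proof.
move=> [[Q1 Q2] [/= q1 q2] sub]; apply: filterS q2 => s Qs.
by apply: sub; split => //=; exact: nbhs_singleton q1.
Qed.

Lemma row2_mul (Q : 'I_2 -> 'rV[R]_3) (a b : R) :
  (\row_(i < 2) (if i == 0 then a else b)) *m (\matrix_(i < 2) Q i) =
  a *: Q 0 + b *: Q 1.
Proof. by apply/rowP => k; rewrite !mxE big_ord2 !mxE. Qed.

Lemma times_nbhs tau : I tau -> 0 < tau -> nbhs tau (fun s => 0 < s /\ I s).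
Proof.
move=> [_ tT] t0.
have N1 : nbhs tau [set s : R | 0 < s] by apply: open_nbhs_nbhs; split; [exact: open_gt|].
suff N2 : nbhs tau [set s : R | (s%:E < T)%E].
  by apply: filterS (filterI N1 N2) => s [/= s0 sT]; split => //; split => //; exact: ltW.
case: T tT => [r| |] //.
- rewrite lte_fin => tr.
  apply: (@filterS _ _ _ [set s : R | s < r]); first by move=> s /=; rewrite lte_fin.
  by apply: open_nbhs_nbhs; split; [exact: open_lt|].
- by move=> _; apply: filterS filterT => s _ /=; rewrite ltry.
Qed.

(** Near a point of space-time, X read in a chart extends to a smooth g on an open
   set, whose derivatives compute the geometric data at times in I; the
   extension is what gives a meaning to smoothness at time 0. *)
Section Extension.
Variables (c : chart R M) (Ac : A c) (O : set V) (g : V -> 'rV[R]_3).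
Hypotheses (oO : open O) (sg : smooth O g).
Hypothesis gE : forall u tau, dom c u -> I tau -> O (u, tau) -> g (u, tau) = X (c u) tau.

Let domc : open (dom c).
Proof. by case: hM => -[hc _ _] _; have [] := hc c Ac. Qed.

Let nearO u tau : dom c u -> O (u, tau) ->
  \forall u' \near u, dom c u' /\ O (u', tau).
Proof.
move=> cu Ou.
have Nc : nbhs u (dom c) by apply: open_nbhs_nbhs; split.
have NO : nbhs ((u, tau) : V) O by apply: open_nbhs_nbhs; split.
have NO' : nbhs u [set u' | O (u', tau)] := nbhs_slice NO.
exact: filterI Nc NO'.
Qed.

Lemma pderiv_extension i u tau : dom c u -> I tau -> O (u, tau) ->
  pderiv i ((X ^~ tau) \o c) u = 'D_(space_dir i) g (u, tau).
Proof.
move=> cu It Ou; rewrite /pderiv -derive_slice; apply: near_eq_derive.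
by apply: filterS (nearO cu Ou) => u' [cu' Ou']; rewrite gE.
Qed.

Lemma pderiv2_extension i j u tau : dom c u -> I tau -> O (u, tau) ->
  pderiv i (pderiv j ((X ^~ tau) \o c)) u =
  'D_(space_dir i) ('D_(space_dir j) g) (u, tau).
Proof.
move=> cu It Ou; rewrite {1}/pderiv -[RHS]derive_slice; apply: near_eq_derive.
by apply: filterS (nearO cu Ou) => u' [cu' Ou']; rewrite pderiv_extension.
Qed.

Lemma normal_extension i u tau : dom c u -> I tau -> O (u, tau) ->
  dot ('D_(space_dir i) g (u, tau)) (nu (c u) tau) = 0.
Proof.
move=> cu It Ou; have [_ + _] := hnu (c u) It => /(_ c u i Ac cu erefl).
by rewrite pderiv_extension.
Qed.

Lemma curvature_extension u tau : dom c u -> I tau -> O (u, tau) ->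
  char_poly ((\matrix_(i, j) - dot ('D_(space_dir i) ('D_(space_dir j) g) (u, tau))
      (nu (c u) tau)) *m
    invmx (\matrix_(i, j) dot ('D_(space_dir i) g (u, tau))
      ('D_(space_dir j) g (u, tau)) : 'M[R]_2)) =
    ('X - (lam1 (c u) tau)%:P) * ('X - (lam2 (c u) tau)%:P).
Proof.
move=> cu It Ou; refine (etrans _ (hlam It Ac cu erefl)).
have e1 : \matrix_(i, j) - dot ('D_(space_dir i) ('D_(space_dir j) g) (u, tau))
      (nu (c u) tau) = second_form ((X ^~ tau) \o c) (nu (c u) tau) u.
  apply/matrixP => i j; rewrite [LHS]mxE [RHS]mxE.
  exact: (congr1 (fun a => - dot a _) (esym (pderiv2_extension i j cu It Ou))).
have e2 : \matrix_(i, j) dot ('D_(space_dir i) g (u, tau))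
      ('D_(space_dir j) g (u, tau)) = first_form ((X ^~ tau) \o c) u.
  apply/matrixP => i j; rewrite [LHS]mxE [RHS]mxE.
  exact: (congr2 (@dot R 3) (esym (pderiv_extension i cu It Ou))
     (esym (pderiv_extension j cu It Ou))).
exact: (congr2 (fun a b => char_poly (a *m invmx b)) e1 e2).
Qed.

Lemma free_extension u tau : dom c u -> I tau -> O (u, tau) ->
  forall a b : R, a *: 'D_(space_dir 0) g (u, tau) + b *: 'D_(space_dir 1) g (u, tau) = 0 ->
  a = 0 /\ b = 0.
Proof.
move=> cu It Ou a b E0; have [_ /(_ c u Ac cu) rf] := hemb It.
pose w : 'rV[R]_2 := \row_i (if i == 0 then a else b).
have w0 : w = 0.
  apply: (row_free_inj rf); rewrite mul0mx -[RHS]E0 row2_mul.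
  by rewrite -(pderiv_extension 0 cu It Ou) -(pderiv_extension 1 cu It Ou).
by split; [have /rowP/(_ 0) := w0 | have /rowP/(_ 1) := w0]; rewrite !mxE.
Qed.

(** Since tau > 0 is interior to I, the one-sided derivative in the hypothesis on
the flow is an ordinary one. *)
Lemma velocity_extension u tau : dom c u -> I tau -> O (u, tau) -> 0 < tau ->
  'D_(time_dir) g (u, tau) =
   - (((lam1 (c u) tau) ^+ 2 + (lam2 (c u) tau) ^+ 2)
              + beta * (lam1 (c u) tau + lam2 (c u) tau) ^+ 2) *: nu (c u) tau.
Proof.
move=> cu It Ou t0; set v : 'rV[R]_3 := (X in _ = X).
have hv : has_velocity I (X (c u)) tau v := @hflow tau (c u) It.
pose f (s : R) : 'rV[R]_3 := (s - tau)^-1 *: (X (c u) s - X (c u) tau).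
have NI := times_nbhs It t0.
have H1 : f s @[s --> tau^'] --> v.
  move=> S /hv HS.
  have HS' : tau^' (fun s => I s -> S (f s)) by exact: HS.
  have NI' : tau^' (fun s => 0 < s /\ I s) by exact: nbhs_dnbhs.
  by apply: filterS2 HS' NI' => s h [_ Is]; exact: h.
have H2 : f s @[s --> tau^'] --> 'D_time_dir g (u, tau).
  have : (fun h : R => h^-1 *: ((g \o shift (u, tau)) (h *: time_dir) - g (u, tau))) @ 0^'
     --> 'D_time_dir g (u, tau) := smooth_derivable (v := time_dir) sg Ou.
  move: ('D_time_dir g (u, tau)) => L.
  move=> /cvgrPdist_lt Hd; apply/cvgrPdist_lt => e e0.
  have [d /= d0 Hd'] := Hd e e0.
  have NO : nbhs ((u, tau) : V) O by apply: open_nbhs_nbhs; split.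
  have [d2 /= d20 Hd2] := filterI (nbhs_slice_time NO) NI.
  exists (Num.min d d2); first by rewrite /= lt_min d0 d20.
  move=> s /=; rewrite lt_min => /andP[sd sd2] st.
  have [Os [_ Is]] := Hd2 s sd2.
  have := Hd' (s - tau); rewrite /= sub0r normrN distrC => /(_ sd).
  rewrite subr_eq0 => /(_ st).
  have -> : ((s - tau) *: (time_dir : V) + (u, tau)) = (u, s).
    congr (_, _); first by rewrite /= scaler0 add0r.
    by rewrite /= [_ *: 1]mulr1 subrK.
  by rewrite (gE cu Is Os) (gE cu It Ou).
exact: (cvg_unique _ H2 H1).
Qed.

End Extension.

(** Up to time 0, the pinching quantity is locally the restriction of a smooth
function W, and the maximum principle holds for W at positive times.  The
graph frame is adapted to the surface at (x0, t0); W is the pinching quantity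
of the graph, and agrees with that of the surface as long as the mean and Gauss
curvatures of the graph stay positive. *)
Lemma local_pinching x0 t0 : I t0 -> exists c u0 (O : set V) (W : V -> R),
  [/\ A c, dom c u0 & c u0 = x0] /\
  [/\ open O, O (u0, t0), smooth O W,
      forall u tau, O (u, tau) -> dom c u -> I tau -> W (u, tau) = pinching (c u) tau &
      0 < t0 -> (forall v, 'D_((v, 0) : V) W (u0, t0) = 0) ->
       (forall v, 'D_((v, 0) : V) ('D_((v, 0) : V) W) (u0, t0) <= 0) ->
       'D_time_dir W (u0, t0) <= 0].
Proof.
move=> It0; have [[hc hcov _] _] := hM.
have [c Ac [u0 cu0 cx0]] := hcov x0.
have SP : (dom c `*` I) ((u0, t0) : V) by split.
have [ O0 [g [oO0 O0P sg gE']]] := hX Ac SP.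
have gE u tau : dom c u -> I tau -> O0 (u, tau) -> g (u, tau) = X (c u) tau.
  by move=> cu It Ou; exact: (gE' (u, tau)).
pose P : V := (u0, t0); pose n := nu (c u0) t0.
have [nn _ _] := hnu (c u0) It0; rewrite -/n in nn.
have n1 := normal_extension Ac oO0 gE 0 cu0 It0 O0P.
have n2 := normal_extension Ac oO0 gE 1 cu0 It0 O0P.
have fr := free_extension Ac oO0 gE cu0 It0 O0P.
have [E1 [E2 [oE fr12]]] := principal_frame
  (- dot ('D_(space_dir 0) ('D_(space_dir 0) g) P) n)
  (- dot ('D_(space_dir 0) ('D_(space_dir 1) g) P) n)
  (- dot ('D_(space_dir 1) ('D_(space_dir 1) g) P) n) nn n1 n2 fr.
pose N := - n; rewrite -/N in oE.
have sJ : smooth O0 (gJ g E1 E2).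
  exact: (smooth_jacobian oO0 (derive_derivation oO0 (space_dir 0))
    (derive_derivation oO0 (space_dir 1)) (smooth_dot E1 oO0 sg) (smooth_dot E2 oO0 sg)).
have X1 := dot_derive oO0 sg 0 E1 O0P; have X2 := dot_derive oO0 sg 1 E1 O0P.
have Y1 := dot_derive oO0 sg 0 E2 O0P; have Y2 := dot_derive oO0 sg 1 E2 O0P.
have [J0P rel] := fr12 _ _ _ _ X1 X2 Y1 Y2.
pose O1 := O0 `&` [set w | gJ g E1 E2 w != 0].
have oO1 : open O1 := open_smooth_preimage oO0 sJ (@open_neq R 0).
have O10 : O1 `<=` O0 by move=> w [].
have J1 w : O1 w -> gJ g E1 E2 w != 0 by case.
have sg1 := smooth_subset O10 sg.
have O1P : O1 P by split; [exact: O0P|exact: J0P].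
have l0 u tau : I tau -> 0 < lam1 (c u) tau /\ 0 < lam2 (c u) tau by move=> It; exact: hconvex.
have geo u tau : dom c u -> I tau -> O1 (u, tau) ->
  exists eps, [/\ eps * eps = 1,
    lam1 (c u) tau + lam2 (c u) tau = eps * gH g E1 E2 N (u, tau) /\
    lam1 (c u) tau * lam2 (c u) tau = gK g E1 E2 N (u, tau),
    [/\ dot (nu (c u) tau) E1 * gv g E1 E2 N (u, tau) = eps * gp g E1 E2 N (u, tau),
        dot (nu (c u) tau) E2 * gv g E1 E2 N (u, tau) = eps * gq g E1 E2 N (u, tau) &
        dot (nu (c u) tau) N * gv g E1 E2 N (u, tau) = - eps] &
    forall i j, - dot ('D_(space_dir i) ('D_(space_dir j) g) (u, tau)) (nu (c u) tau)
        * gv g E1 E2 N (u, tau) = eps *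
      (gr g E1 E2 N (u, tau) *
         ('D_(space_dir i) (gx g E1) (u, tau) * 'D_(space_dir j) (gx g E1) (u, tau)) +
       (gs g E1 E2 N (u, tau) *
         ('D_(space_dir i) (gx g E1) (u, tau) * 'D_(space_dir j) (gy g E2) (u, tau)
         + 'D_(space_dir j) (gx g E1) (u, tau) * 'D_(space_dir i) (gy g E2) (u, tau))
        + gt g E1 E2 N (u, tau) *
         ('D_(space_dir i) (gy g E2) (u, tau) * 'D_(space_dir j) (gy g E2) (u, tau))))].
  move=> cu It Ou; have [nn' _ _] := hnu (c u) It.
  exact: (graph_curvatures oO1 sg1 J1 Ou oE nn'
   (fun i => normal_extension Ac oO0 gE i cu It (O10 _ Ou))
   (curvature_extension Ac oO0 gE cu It (O10 _ Ou))).
have [[pP qP sP] [vP rP tP HP KP]] :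
  [/\ gp g E1 E2 N P = 0, gq g E1 E2 N P = 0 & gs g E1 E2 N P = 0] /\
  [/\ gv g E1 E2 N P = 1, 0 < gr g E1 E2 N P, 0 < gt g E1 E2 N P,
     0 < gH g E1 E2 N P & 0 < gK g E1 E2 N P].
  have [eps [he [hl hm] [ha hb hg] hij]] := geo u0 t0 cu0 It0 O1P.
  have [l10 l20] := l0 u0 t0 It0.
  have [[_ _ _] [_ EN1 EN2]] := oE.
  have nE1 : dot n E1 = 0.
    by apply: oppr_inj; rewrite oppr0 dotC -EN1 /N dotNr.
  have nE2 : dot n E2 = 0.
    by apply: oppr_inj; rewrite oppr0 dotC -EN2 /N dotNr.
  have nN : dot n N = - 1 by rewrite /N dotNr nn.
  rewrite -/n nE1 in ha; rewrite -/n nE2 in hb.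
  exact: (graph_base_point J0P (gv_gt0 g E1 E2 N P) (gH_v g E1 E2 N P)
    (gK_v g E1 E2 N P) he hl hm l10 l20 ha hb hg nN (hij 0 0) (hij 0 1) (hij 1 1) rel).
have sH1 : smooth O1 (gH g E1 E2 N) := smooth_gH N oO1 sg1 J1.
have sK1 : smooth O1 (gK g E1 E2 N) := smooth_gK N oO1 sg1 J1.
pose OH := O1 `&` [set w | 0 < gH g E1 E2 N w].
have oOH : open OH := open_smooth_preimage oO1 sH1 (@open_gt R 0).
have OH1 : OH `<=` O1 by move=> w [].
pose O2 := OH `&` [set w | 0 < gK g E1 E2 N w].
have oO2 : open O2 := open_smooth_preimage oOH (smooth_subset OH1 sK1) (@open_gt R 0).
have O21 : O2 `<=` O1 by move=> w [[]].
have O2P : O2 P by [].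
have J2 w : O2 w -> gJ g E1 E2 w != 0 by move=> /O21 /J1.
have K2 w : O2 w -> gK g E1 E2 N w != 0 by move=> [_ /= k]; rewrite gt_eqF.
have sg2 := smooth_subset O21 sg1.
have sW := smooth_gW (N := N) oO2 sg2 J2 K2.
(* both mean curvatures are positive: the sign eps is 1 *)
have geo2 u tau : dom c u -> I tau -> O2 (u, tau) ->
  [/\ lam1 (c u) tau + lam2 (c u) tau = gH g E1 E2 N (u, tau),
      lam1 (c u) tau * lam2 (c u) tau = gK g E1 E2 N (u, tau) &
  [/\ dot (nu (c u) tau) E1 * gv g E1 E2 N (u, tau) = gp g E1 E2 N (u, tau),
      dot (nu (c u) tau) E2 * gv g E1 E2 N (u, tau) = gq g E1 E2 N (u, tau) &
      dot (nu (c u) tau) N * gv g E1 E2 N (u, tau) = - 1]].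
  move=> cu It Ou; have [eps [he [hl hm] [ha hb hg] _]] := geo u tau cu It (O21 _ Ou).
  have [l10 l20] := l0 u tau It; have [[_ /= H0] _] := Ou.
  have e0 : 0 < eps by rewrite -(pmulr_lgt0 _ H0) -hl addr_gt0.
  have e1 := sign_eq1 he e0.
  by rewrite hl ha hb hg e1 !mul1r.
exists c, u0, O2, (gW g E1 E2 N); split; first by split.
split=> //.
  move=> u tau Ou cu It; have [eH eK _] := geo2 u tau cu It Ou.
  have [l10 l20] := l0 u tau It.
  by rewrite /pinching pinching_HK // eH eK.
move=> t00 W1 W2.
pose O3 := O2 `&` [set w | dom c w.1 /\ (0 < w.2 /\ I w.2)].
have domc : open (dom c) by have [] := hc c Ac.
have oO3 : open O3.
  rewrite openE => -[u tau] [Ou [/= cu [tau0 It]]]; rewrite /interior.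
  have N1 : nbhs ((u, tau) : V) O2 by apply: open_nbhs_nbhs; split.
  have N2 : nbhs ((u, tau) : V) [set w | dom c w.1 /\ (0 < w.2 /\ I w.2)].
    exists (dom c, (fun s => 0 < s /\ I s)) => //=.
    by split; [apply: open_nbhs_nbhs; split|exact: times_nbhs].
  exact: filterI N1 N2.
have O32 : O3 `<=` O2 by move=> w [].
have O3P : O3 P by [].
have J3 w : O3 w -> gJ g E1 E2 w != 0 by move=> /O32 /J2.
have K3 w : O3 w -> gK g E1 E2 N w != 0 by move=> /O32 /K2.
have sg3 := smooth_subset O32 sg2.
have h0 := gD0_derivation oO3 sg3 J3.
have h1 := gD1_derivation oO3 sg3 J3.
have h2 := gD2_derivation oO3 sg3 J3.
have Ez w : O3 w -> gD0 g E1 E2 (gz g N) w = gF g E1 E2 N beta w * gv g E1 E2 N w.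
  case: w => u tau Ow; have [Ow2 [/= cu [tau0 It]]] := Ow.
  have [eH eK [ea eb ec]] := geo2 u tau cu It Ow2.
  have Ow0 := O10 _ (O21 _ Ow2).
  have vel := velocity_extension oO0 sg gE cu It Ow0 tau0.
  have DE E : 'D_time_dir (fun w => dot (g w) E) (u, tau) =
     - gF g E1 E2 N beta (u, tau) * dot (nu (c u) tau) E.
    rewrite (derive_dot _ _ oO0 sg Ow0) vel dotZl; congr (_ * _); congr (- _).
    by rewrite /gF -eH -eK; ring.
  apply: etrans (graph_d0E _ _ _ _ _ _ _) _.
  have := DE N; have := DE E1; have := DE E2; rewrite -/(gz g N) -/(gx g E1) -/(gy g E2).
  have := gv_sqr g E1 E2 N (u, tau); have := gv_gt0 g E1 E2 N (u, tau).
  rewrite -[graph_d1 _ _ _ _ _ _ _]/(gp g E1 E2 N (u, tau)).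
  rewrite -[graph_d2 _ _ _ _ _ _ _]/(gq g E1 E2 N (u, tau)).
  move: ea eb ec.
  move: (gp g E1 E2 N (u, tau)) (gq g E1 E2 N (u, tau)) (gv g E1 E2 N (u, tau))
   (gF g E1 E2 N beta (u, tau)) ('D_time_dir (gx g E1) (u, tau))
   ('D_time_dir (gy g E2) (u, tau)) ('D_time_dir (gz g N) (u, tau)).
  move=> p q v F a b d <- <- ec v0 vv -> -> ->.
  move: (dot _ E1) (dot _ E2) (dot _ N) ec vv => n1' n2' n3' ec vv.
  apply: (mulIf (lt0r_neq0 v0)).
  transitivity (F * (n1' * v * (n1' * v) + n2' * v * (n2' * v)) - F * (n3' * v)); first by ring.
  by rewrite ec -(mulrA F v v) vv; ring.
have sW3 := smooth_subset O32 sW.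
have w1 := W1 (delta_mx 0 0); have w2 := W1 (delta_mx 0 1).
have D1 : gD1 g E1 E2 (gW g E1 E2 N) P = 0.
  apply: etrans (graph_d1E _ _ _ _ _ _ _) _.
  apply: etrans (congr2 (fun a b => _ * (_ * a - _ * b)) w1 w2) _.
  exact: mulr_sub_mulr0.
have D2 : gD2 g E1 E2 (gW g E1 E2 N) P = 0.
  apply: etrans (graph_d2E _ _ _ _ _ _ _) _.
  apply: etrans (congr2 (fun a b => _ * (_ * a - _ * b)) w2 w1) _.
  exact: mulr_sub_mulr0.
have hd i := derive_derivation oO3 (space_dir i).
have sx3 := smooth_dot E1 oO3 sg3; have sy3 := smooth_dot E2 oO3 sg3.
have xiE (a b : R) : a *: (space_dir 0 : V) + b *: (space_dir 1 : V) =
    (a *: delta_mx 0 0 + b *: delta_mx 0 1, 0).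
  by apply: (congr2 pair) => //; apply: etrans (congr2 +%R (mulr0 a) (mulr0 b)) _; rewrite addr0.
have D11 : gD1 g E1 E2 (gD1 g E1 E2 (gW g E1 E2 N)) P <= 0.
  have [s1 s2] := graph_d1_coef_smooth oO3 (hd 0) (hd 1) sx3 sy3 J3.
  have E := vfield_critical oO3 time_dir s1 s2 sW3 O3P w1 w2.
  move: E; cbv zeta; rewrite xiE => E.
  exact: (eq_ind_r (fun z => z <= 0) (W2 _) E).
have D22 : gD2 g E1 E2 (gD2 g E1 E2 (gW g E1 E2 N)) P <= 0.
  have [s1 s2] := graph_d2_coef_smooth oO3 (hd 0) (hd 1) sx3 sy3 J3.
  have E := vfield_critical oO3 time_dir s1 s2 sW3 O3P w1 w2.
  move: E; cbv zeta; rewrite xiE => E.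
  exact: (eq_ind_r (fun z => z <= 0) (W2 _) E).
have D0 : gD0 g E1 E2 (gW g E1 E2 N) P <= 0.
  apply: (graph_flow_pinching_le0 oO3 O3P h0 h1 h2
    (fun f w => @gD01 _ g E1 E2 O3 oO3 sg3 J3 f w)
    (fun f w => @gD02 _ g E1 E2 O3 oO3 sg3 J3 f w)
    (fun f w => @gD12 _ g E1 E2 O3 oO3 sg3 J3 f w)
    (smooth_dot N oO3 sg3) (smooth_gv N oO3 sg3 J3) (smooth_gH N oO3 sg3 J3)
    (smooth_gK N oO3 sg3 J3) (smooth_gF N beta oO3 sg3 J3) sW3 hbeta
    (fun w _ => gv_sqr g E1 E2 N w) (fun w _ => gH_v g E1 E2 N w)
    (fun w _ => gK_v g E1 E2 N w) (fun w _ => erefl)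
    (fun w Ow => gW_K (K3 w Ow)) Ez pP qP sP vP rP tP D1 D2 D11 D22).
have E0 : gD0 g E1 E2 (gW g E1 E2 N) P = 'D_time_dir (gW g E1 E2 N) P.
  apply: etrans (graph_d0E _ _ _ _ _ _ _) _.
  apply: etrans (congr2 (fun a b => _ - (_ * a + _ * b)) D1 D2) _.
  by rewrite !mulr0 addr0 subr0.
exact: (eq_ind _ (fun z => z <= 0) D0 _ E0).
Qed.

End Local.

(** * The maximum principle *)

Lemma ray_lower (R : realType) (V : normedModType R) (O : set V) (f : V -> R) x v (e : R) :
  open O -> smooth O f -> O x -> - e < 'D_v f x ->
  exists2 d : R, 0 < d & forall h, 0 < h <= d -> f x - e * h < f (x + h *: v).
Proof.
move=> oO sf Ox De.
have cD : {for x, continuous ('D_v f)} := smooth_continuous (smooth_derive v sf) Ox.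
have N1 : nbhs x [set y | - e < 'D_v f y].
  by apply: (cD [set y : R | - e < y]); apply: open_nbhs_nbhs; split; [exact: open_gt|].
have N2 : nbhs x O by apply: open_nbhs_nbhs; split.
have [d d0 Hd] := nbhs_line v (filterI N2 N1); exists d => // h /andP[h0 hd].
have [s hs|s /andP[s0 sh] E] := line_mvt sf h0 (x := x) (v := v).
  by have [] // := Hd s; case/andP: hs => -> /le_trans ->.
have hs : 0 <= s <= d by rewrite s0 (le_trans sh).
have [_ /= Ds] := Hd s hs.
have -> : f (x + h *: v) = f x + h * 'D_v f (x + s *: v) by rewrite -E [RHS]addrC subrK.
by rewrite ltrD2l -mulNr mulrC ltr_pM2l.
Qed.

Section MaximumPrinciple.
Context {R : realType}.
Variables (beta : R) (T : \bar R)
    (M : topologicalType) (A : set (chart R M)) (X : M -> R -> 'rV[R]_3)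
    (nu : M -> R -> 'rV[R]_3) (lam1 lam2 : M -> R -> R).
Hypotheses (hbeta : 0 <= beta <= 5)
    (hM : closed_surface A)
    (hX : smooth_family A (times T) X)
    (hemb : forall t, times T t -> embedding A (X ^~ t))
    (hnu : forall t x, times T t -> outer_unit_normal A (X ^~ t) x (nu x t))
    (hlam : forall t x, times T t ->
       principal_curvatures A (X ^~ t) x (nu x t) (lam1 x t) (lam2 x t))
    (hconvex : forall t x, times T t -> 0 < lam1 x t /\ 0 < lam2 x t)
    (hflow : forall t x, times T t ->
       has_velocity (times T) (X x) t
         (- (((lam1 x t) ^+ 2 + (lam2 x t) ^+ 2)
              + beta * (lam1 x t + lam2 x t) ^+ 2) *: nu x t)).
Local Notation V := ('rV[R]_2 * R)%type.
Local Notation I := (times T).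
Local Notation w := (pinching lam1 lam2).

Let local := local_pinching hbeta hM hX hemb hnu hlam hconvex hflow.

(** Continuity on M * I, including the time 0, is transported from the chart,
whose open sets are mapped to open sets of M. *)
Lemma pinching_continuous x0 t0 : I t0 ->
  (fun z : M * R => w z.1 z.2) @ within [set z | I z.2] (nbhs (x0, t0)) --> w x0 t0.
Proof.
move=> It0; have [c [u0 [ O [W [[Ac cu0 cx0] [oO OP sW WE _]]]]]] := local x0 It0.
have [[hc _ _] _] := hM; have [domc _ _ opc] := hc c Ac.
have W0 : W (u0, t0) = w x0 t0 by rewrite WE // cx0.
move=> S; rewrite -W0 => nS.
have cW : {for (u0, t0), continuous W} := smooth_continuous sW OP.
have NW : nbhs ((u0, t0) : V) (O `&` [set z | S (W z)]).
  by apply: filterI; [apply: open_nbhs_nbhs; split|exact: (cW S nS)].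
have [[Q1 Q2] [/= q1 q2] sub] := NW.
pose U := (Q1 `&` dom c)°.
have NU : nbhs u0 (Q1 `&` dom c).
  by apply: filterI => //; apply: open_nbhs_nbhs; split.
have oU : open U := open_interior _.
have Uu0 : U u0 := NU.
have Usub : U `<=` Q1 `&` dom c := @interior_subset _ _.
have ocU : open (c @` U) by apply: opc => // u /Usub [].
exists ((c @` U), Q2) => /=.
  by split => //; apply: open_nbhs_nbhs; split => //; exists u0.
move=> [x t] [/= [u Uu <-] Qt] It.
have [Q1u cu] := Usub _ Uu.
have [Ou Su] : (O `&` [set z | S (W z)]) (u, t) by apply: sub.
by move: Su; rewrite /= WE.
Qed.

Lemma times_itv s t t' : I s -> I t' -> s <= t <= t' -> I t.
Proof.
move=> [s0 _] [_ tT] /andP[st tt']; split; first exact: le_trans st.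
by apply: le_lt_trans tT; rewrite lee_fin.
Qed.

Lemma slab_max (e s t1 : R) : I s -> I t1 -> s <= t1 ->
  exists x t, s <= t <= t1 /\
    forall x' t', s <= t' <= t1 -> w x' t' - e * t' <= w x t - e * t.
Proof.
move=> Is It1 st1.
pose K : set (M * R) := [set: M] `*` [set t | s <= t <= t1].
have KI z : K z -> I z.2 by move=> [_ h]; exact: times_itv Is It1 h.
have [_ [_ [x0 _] cM _]] := hM.
have K0 : K !=set0 by exists (x0, s); split => //=; rewrite lexx.
have cK : compact K.
  apply: compact_setX => //.
  have -> : [set t | s <= t <= t1] = [set` `[s, t1]].
    by apply/seteqP; split=> t /=; rewrite in_itv.
  exact: segment_compact.
have cf : {within K, continuous (fun z : M * R => w z.1 z.2 - e * z.2)}.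
  apply/subspace_continuousP => -[x t] Kz.
  apply: cvgB.
    move=> S nS.
    have HS : nbhs (x, t) (fun z : M * R => I z.2 -> S (w z.1 z.2)) :=
      @pinching_continuous x t (KI _ Kz) S nS.
    suff : nbhs (x, t) (fun z : M * R => K z -> S (w z.1 z.2)) by [].
    by apply: filterS HS => z Hz Kz'; exact: Hz (KI _ Kz').
  apply: cvgM; first exact: cvg_cst.
  move=> S nS.
  suff : nbhs (x, t) (fun z : M * R => K z -> S z.2) by [].
  exists (setT, S) => /=; first by split => //; exact: filterT.
  by move=> z [_ /= Sz] _.
have [[x t] /set_mem [_ /= st] Hmax] := compact_EVT_max K0 cK cf.
exists x, t; split=> // x' t' st'.
by apply: (Hmax (x', t')); rewrite inE; split.
Qed.

(** At a maximum (x0, t) of w - e t over the slab with t > s, the point x0 is a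
spatial maximum of w at time t, so that w_t <= 0; the slab contains earlier
times, so that w_t >= e, a contradiction. *)
Lemma slab_max_initial (e s t1 t : R) (x0 : M) : 0 < e -> I s -> I t1 -> s < t <= t1 ->
  exists x' t', s <= t' <= t1 /\ w x0 t - e * t < w x' t' - e * t'.
Proof.
move=> e0 Is It1 /andP[st tt1]; apply: contrapT => noex.
have Hmax x' t' : s <= t' <= t1 -> w x' t' - e * t' <= w x0 t - e * t.
  by move=> st'; rewrite leNgt; apply/negP => lt; apply: noex; exists x', t'.
have It : I t by apply: (times_itv Is It1); rewrite (ltW st).
have t0 : 0 < t by case: Is => s0 _; exact: le_lt_trans st.
have [c [u0 [ O [W [[Ac cu0 cx0] [oO OP sW WE Wev]]]]]] := local x0 It.
have [[hc _ _] _] := hM; have [domc _ _ _] := hc c Ac.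
have W0 : W (u0, t) = w x0 t by rewrite WE // cx0.
have NO : nbhs ((u0, t) : V) O by apply: open_nbhs_nbhs; split.
have Nd : nbhs ((u0, t) : V) [set z | dom c z.1].
  exists (dom c, setT) => /=; last by move=> z [].
  by split; [apply: open_nbhs_nbhs; split|exact: filterT].
have ray v : exists2 d : R, 0 < d & forall h, 0 <= h <= d ->
    W ((u0, t) + h *: ((v, 0) : V)) <= W (u0, t).
  have [d d0 Hd] := nbhs_line ((v, 0) : V) (filterI NO Nd); exists d => // h hd.
  have := Hd h hd.
  have -> : ((u0, t) : V) + h *: ((v, 0) : V) = (u0 + h *: v, t).
    by apply: (congr2 pair) => //; apply: etrans (congr1 (+%R t) (mulr0 h)) _; rewrite addr0.
  move=> [Oh /= ch]; rewrite W0 WE //.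
  have := Hmax (c (u0 + h *: v)) t; rewrite (ltW st) tt1 => /(_ isT).
  by rewrite lerD2r.
have W1 v : 'D_((v, 0) : V) W (u0, t) = 0.
  apply: (derive_eq0_ray_max oO sW OP) => z [->|->]; first exact: ray.
  have -> : - ((v, 0) : V) = (- v, 0) by apply: (congr2 pair) => //; exact: oppr0.
  exact: ray.
have W2 v : 'D_((v, 0) : V) ('D_((v, 0) : V) W) (u0, t) <= 0.
  exact: (derive2_le0_ray_max oO sW OP (ray v) (W1 v)).
have Wt := Wev t0 W1 W2.
(* going backwards in time from t, w - e t increases *)
have De : - e < 'D_(- (time_dir : V)) W (u0, t).
  rewrite -[- (time_dir : V)]scaleN1r (derive_scalev _ _ oO sW OP) mulN1r.
  by apply: (@lt_le_trans _ _ 0); rewrite ?oppr_lt0 ?oppr_ge0.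
have [d d0 Hd] := ray_lower oO sW OP De.
have [d' d'0 Hd'] := nbhs_line (- (time_dir : V)) (filterI NO Nd).
pose h := Num.min (t - s) (Num.min d d').
have h0 : 0 < h by rewrite !lt_min subr_gt0 st d0.
have hd : h <= d by rewrite /h !ge_min lexx orbT.
have hd' : h <= d' by rewrite /h !ge_min lexx !orbT.
have hts : h <= t - s by rewrite /h !ge_min lexx.
have := Hd h; rewrite h0 hd => /(_ isT).
have := Hd' h; rewrite (ltW h0) hd' => /(_ isT).
have -> : ((u0, t) : V) + h *: (- (time_dir : V)) = (u0, t - h).
  apply: (congr2 pair).
    by apply: etrans (congr1 (fun z => u0 + h *: z) (oppr0 _)) _; rewrite scaler0 addr0.
  exact: (congr1 (+%R t) (mulrN1 h)).
move=> [Oh _].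
have sth : s <= t - h <= t1.
  rewrite lerBrDr -lerBrDl hts /=; apply: le_trans tt1.
  by rewrite gerBl ltW.
have Ith := times_itv Is It1 sth.
rewrite W0 (WE _ _ Oh cu0 Ith) cx0 => lt1.
have := Hmax x0 _ sth; rewrite leNgt => /negP; apply.
by rewrite mulrBr; lra.
Qed.

End MaximumPrinciple.

Theorem theorem8p2 (R : realType) (beta : R) (T : \bar R)
    (M : topologicalType) (A : set (chart R M)) (X : M -> R -> 'rV[R]_3)
    (nu : M -> R -> 'rV[R]_3) (lam1 lam2 : M -> R -> R)
    (hbeta : 0 <= beta <= 5)
    (hM : closed_surface A)
    (hX : smooth_family A (times T) X)
    (hemb : forall t, times T t -> embedding A (X ^~ t))
    (hnu : forall t x, times T t -> outer_unit_normal A (X ^~ t) x (nu x t))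
    (hlam : forall t x, times T t ->
       principal_curvatures A (X ^~ t) x (nu x t) (lam1 x t) (lam2 x t))
    (hconvex : forall t x, times T t -> 0 < lam1 x t /\ 0 < lam2 x t)
    (hflow : forall t x, times T t ->
       has_velocity (times T) (X x) t
         (- (((lam1 x t) ^+ 2 + (lam2 x t) ^+ 2)
              + beta * (lam1 x t + lam2 x t) ^+ 2) *: nu x t)) :
  exists m : R -> R,
    (forall t, times T t ->
       is_max (range (fun x : M =>
         (lam1 x t + lam2 x t) * (lam1 x t - lam2 x t) ^+ 2
           / (2 * lam1 x t * lam2 x t))) (m t)) /\
    (forall s t, times T s -> times T t -> s <= t -> m t <= m s).
Proof.
pose w := pinching lam1 lam2.
have slab := slab_max hbeta hM hX hemb hnu hlam hconvex hflow.
have maxE t : exists v, times T t -> is_max (range (fun x => w x t)) v.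
  have [It|nIt] := pselect (times T t); last by exists 0.
  have [x [t' [tt' Hx]]] := slab 0 t t It It (lexx t).
  have {tt'} Et : t' = t by apply/le_anti; rewrite andbC.
  exists (w x t) => _; split; first by exists x.
  move=> _ [x' _ <-]; have := Hx x' t; rewrite lexx Et !mul0r !subr0; exact.
have [m Hm] := choice maxE; exists m; split; first exact: Hm.
move=> s t Is It st; apply/ler_addgt0Pr => d d0.
have ts0 : 0 < t - s + 1 by rewrite ltr_pwDr // subr_ge0.
pose e := d / (t - s + 1).
have e0 : 0 < e by rewrite divr_gt0.
have [x [t' [st' Hx]]] := slab e s t Is It st.
have Et : t' = s.
  apply/eqP; rewrite eq_le; case/andP: (st') => -> t't; rewrite andbT leNgt; apply/negP => lt.
  have lt' : s < t' <= t by rewrite lt.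
  have [x' [t'' [h1 h2]]] :=
    slab_max_initial hbeta hM hX hemb hnu hlam hconvex hflow x e0 Is It lt'.
  by have := Hx x' t'' h1; rewrite leNgt h2.
have [[y _ Ey] _] := Hm t It; have [_ ub] := Hm s Is.
have Eyt : pinching lam1 lam2 y t = m t := Ey.
have := Hx y t; rewrite st lexx => /(_ isT); rewrite Et Eyt => h1.
have h2 : pinching lam1 lam2 x s <= m s by apply: ub; exists x.
have h3 : e * (t - s) <= d.
  rewrite /e mulrAC ler_pdivrMr // ler_pM2l // lerDl //.
by lra.
Qed.
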